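(* When $6\le n\le 7$ and $2\le m\le n-3$, there exists a complete smooth Riemannian metric on $\mathbb{S}^{n-m}\times \mathbb{T}^{m-1}\times\mathbb{R}$ with uniformly positive $m$-intermediate curvature.
   Context: $\mathbb{T}^{j}$ denotes the $j$-dimensional torus. The $m$-intermediate curvature of an $n$-dimensional Riemannian manifold $(N,g)$ ($1\le m\le n-1$): for orthonormal vectors $e_1,\dots,e_m\in T_pN$, extended to an orthonormal basis $e_1,\dots,e_n$ of $T_pN$, set $$C^N_m(e_1,\dots,e_m)=\sum_{p=1}^m\sum_{q=p+1}^n R^N(e_p,e_q,e_p,e_q),$$ where $R^N(e_p,e_q,e_p,e_q)$ is the sectional curvature of the plane spanned by $e_p,e_q$. Let $C_m^N(p)=\min\{C_m^N(e_1,\dots,e_m):\{e_1,\dots,e_m\}\text{ orthonormal in }T_pN\}$. $(N,g)$ has uniformly positive $m$-intermediate curvature if there is a constant $\lambda>0$ such that $C_m^N(p)\ge\lambda$ for all $p\in N$. *)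

(* Defs.v *)
From HB Require Import structures.
From mathcomp Require Import all_boot all_order all_algebra.
From mathcomp Require Import ring lra.
From mathcomp Require Import all_classical all_reals all_analysis.
Set Implicit Arguments.
Unset Strict Implicit.
Unset Printing Implicit Defensive.
Import Order.TTheory GRing.Theory Num.Theory.
Import numFieldNormedType.Exports.
Local Open Scope classical_set_scope.
Local Open Scope ring_scope.

Definition pd (R : realType) (d : nat) (a : 'I_d) (f : 'rV[R]_d -> R) :
  'rV[R]_d -> R := fun u => 'D_(delta_mx 0 a) f u.

Fixpoint Ck (R : realType) (d : nat) (k : nat) (U : set 'rV[R]_d)
    (f : 'rV[R]_d -> R) : Prop :=
  (forall u, U u -> {for u, continuous f}) /\
  (if k is k'.+1 then
     forall a : 'I_d,
       (forall u, U u -> derivable f u (delta_mx 0 a)) /\ Ck k' U (pd a f)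
   else True).

Definition smooth_on (R : realType) (d : nat) (U : set 'rV[R]_d)
    (f : 'rV[R]_d -> R) : Prop := forall k, Ck k U f.

(** The topology of a manifold is the one induced by its charts, so no topology
    on the carrier is assumed: [overlap_open], [transition_smooth], [hausdorff]
    and the countability of the set of charts are the hypotheses under which an
    atlas on a bare set determines a (second countable, Hausdorff) smooth
    manifold. [param i] is the inverse of the coordinate map [coord i]; it is
    only meaningful on the image of the chart. *)

Record manifold (R : realType) (d : nat) := Manifold {
  point :> Type;
  chart : countType;
  dom : chart -> set point;
  coord : chart -> point -> 'rV[R]_d;
  param : chart -> 'rV[R]_d -> point;
  coordK : forall i x, dom i x -> param i (coord i x) = x;
  dom_cover : forall x, exists i, dom i x;
  overlap_open : forall i j, open (coord i @` (dom i `&` dom j));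
  transition_smooth : forall i j (b : 'I_d),
    smooth_on (coord i @` (dom i `&` dom j))
              (fun u => coord j (param i u) 0 b);
  hausdorff : forall x y, x <> y -> exists i j (A B : set 'rV[R]_d),
    [/\ open A /\ open B,
        dom i x /\ A (coord i x),
        dom j y /\ B (coord j y) &
        forall z, dom i z -> dom j z -> A (coord i z) -> B (coord j z) ->
          False]
}.

Definition chart_image (R : realType) (d : nat) (M : manifold R d)
  (i : chart M) : set 'rV[R]_d := coord i @` dom i.

Section Calculus.
Variables (R : realType) (d : nat).
Implicit Types (U V : set 'rV[R]_d) (f g : 'rV[R]_d -> R) (k : nat).

Lemma Ck_cont k U f u : Ck k U f -> U u -> {for u, continuous f}.
Proof. by case: k => [|k] [+ _]; exact. Qed.

Lemma Ck_subset k U V f : V `<=` U -> Ck k U f -> Ck k V f.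
Proof.
move=> VU; elim: k f => [|k IH] f [cf Df].
  by split => // u /VU /cf.
split; first by move=> u /VU /cf.
move=> a; have [D1 D2] := Df a; split; last exact: IH.
by move=> u /VU /D1.
Qed.

Lemma CkW k U f : Ck k.+1 U f -> Ck k U f.
Proof.
elim: k f => [|k IH] f [cf Df]; first by split.
by split=> // a; have [D1 D2] := Df a; split => //; apply: IH.
Qed.

Lemma near_eq_open U f g u : open U -> (forall v, U v -> f v = g v) -> U u ->
  \near u, f u = g u.
Proof. by move=> oU fg Uu; apply: (filterS fg); exact: open_nbhs_nbhs. Qed.

Lemma cont_ext U f g u : open U -> (forall v, U v -> f v = g v) -> U u ->
  {for u, continuous f} -> {for u, continuous g}.
Proof.
move=> oU fg Uu; rewrite /prop_for /continuous_at -(fg _ Uu) => cf.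
by apply: cvg_trans cf; exact: (@near_eq_cvg _ _ (nbhs u) _ _ _ (near_eq_open oU fg Uu)).
Qed.

Lemma Ck_ext k U f g : open U -> (forall u, U u -> f u = g u) ->
  Ck k U f -> Ck k U g.
Proof.
move=> oU; elim: k f g => [|k IH] f g fg [cf Df].
  by split=> // u Uu; exact: cont_ext oU fg Uu (cf _ Uu).
split=> [u Uu|a]; first exact: cont_ext oU fg Uu (cf _ Uu).
have [D1 D2] := Df a; split=> [u Uu|].
  by apply: near_eq_derivable (D1 _ Uu); exact: near_eq_open oU fg Uu.
by apply: IH D2 => u Uu; apply: near_eq_derive; exact: near_eq_open oU fg Uu.
Qed.

Lemma Ck_cst k U (c : R) : Ck k U (fun=> c).
Proof.
elim: k c => [|k IH] c; first by split => // u _; exact: cst_continuous.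
split=> [u _|a]; first exact: cst_continuous.
split=> [u _|]; first exact: derivable_cst.
rewrite [pd _ _](_ : _ = fun=> 0); first exact: IH.
by apply/funext => u; rewrite /pd derive_cst.
Qed.

Lemma Ck_add k U f g : open U -> Ck k U f -> Ck k U g ->
  Ck k U (fun u => f u + g u).
Proof.
move=> oU; elim: k f g => [|k IH] f g [cf Df] [cg Dg].
  by split => // u Uu; apply: continuousD; [exact: cf|exact: cg].
split=> [u Uu|a]; first by apply: continuousD; [exact: cf|exact: cg].
have [D1 D2] := Df a; have [E1 E2] := Dg a; split=> [u Uu|].
  by apply: derivableD; [exact: D1|exact: E1].
apply: Ck_ext (IH _ _ D2 E2) => // u Uu.
by rewrite /pd deriveD //; [exact: D1|exact: E1].
Qed.

Lemma Ck_mul k U f g : open U -> Ck k U f -> Ck k U g ->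
  Ck k U (fun u => f u * g u).
Proof.
move=> oU; elim: k f g => [|k IH] f g Cf Cg.
  have [cf _] := Cf; have [cg _] := Cg.
  by split => // u Uu; apply: continuousM; [exact: cf|exact: cg].
have [cf Df] := Cf; have [cg Dg] := Cg.
split=> [u Uu|a]; first by apply: continuousM; [exact: cf|exact: cg].
have [D1 D2] := Df a; have [E1 E2] := Dg a; split=> [u Uu|].
  by apply: derivableM; [exact: D1|exact: E1].
have H : Ck k U (fun u => f u * pd a g u + g u * pd a f u).
  by apply: Ck_add => //; apply: IH => //; exact: CkW.
apply: Ck_ext H => // u Uu.
by rewrite /pd deriveM //; [exact: D1|exact: E1].
Qed.

Lemma Ck_sum k U (I : finType) (F : I -> 'rV[R]_d -> R) : open U ->
  (forall i, Ck k U (F i)) -> Ck k U (fun u => \sum_i F i u).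
Proof.
move=> oU CF; elim: (index_enum I) => [|i s IH].
  apply: Ck_ext (Ck_cst k U 0) => // u _; by rewrite big_nil.
apply: Ck_ext (Ck_add oU (CF i) IH) => // u _; by rewrite big_cons.
Qed.

Lemma Ck_inv k U f : open U -> (forall u, U u -> f u != 0) -> Ck k U f ->
  Ck k U (fun u => (f u)^-1).
Proof.
move=> oU f0; elim: k => [|k IH] Cf.
  have [cf _] := Cf.
  by split => // u Uu; apply: continuousV; [exact: f0|exact: cf].
have [cf Df] := Cf.
split=> [u Uu|a]; first by apply: continuousV; [exact: f0|exact: cf].
have [D1 D2] := Df a; split=> [u Uu|].
  by apply: derivableV; [exact: f0|exact: D1].
have Ci := IH (CkW Cf).
have H : Ck k U (fun u => (-1) * ((f u)^-1 * (f u)^-1) * pd a f u).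
  apply: Ck_mul => //; apply: Ck_mul => //; first exact: Ck_cst.
  exact: Ck_mul.
apply: Ck_ext H => // u Uu.
rewrite /pd deriveV //; [|exact: f0|exact: D1].
by rewrite -exprVn expr2 mulN1r.
Qed.

Lemma Ck_coord k U (b : 'I_d) : Ck k U (fun u => u 0 b).
Proof.
have cc (u : 'rV[R]_d) : {for u, continuous (fun v : 'rV[R]_d => v 0 b)}.
  exact: coord_continuous.
case: k => [|k]; first by split.
split=> // a; split=> [u _|].
  by apply: diff_derivable; exact: differentiable_coord.
rewrite [pd _ _](_ : _ = fun=> (delta_mx 0 a : 'rV[R]_d) 0 b).
  exact: Ck_cst.
apply/funext => u; rewrite /pd.
have D := @derivable_id _ _ u (delta_mx 0 a : 'rV[R]_d).
by rewrite -[in RHS](derive_id u (delta_mx 0 a)) (derive_mx D) mxE.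
Qed.

End Calculus.

Lemma Ck_comp_linear (R : realType) d d' (L : {linear 'rV[R]_d' -> 'rV[R]_d}) :
  continuous L ->
  (forall a, L (delta_mx 0 a) = 0 \/ exists b, L (delta_mx 0 a) = delta_mx 0 b) ->
  forall k U (f : 'rV[R]_d -> R), Ck k U f -> Ck k (L @^-1` U) (f \o L).
Proof.
move=> cL HL k U; elim: k => [|k IH] f [cf Df].
  by split=> // u Uu; apply: continuous_comp; [exact: cL|exact: cf].
split=> [u Uu|a]; first by apply: continuous_comp; [exact: cL|exact: cf].
have E u : (fun h : R => h^-1 *: ((f \o L) (h *: delta_mx 0 a + u) -
               (f \o L) u)) =
           (fun h : R => h^-1 *: (f (h *: L (delta_mx 0 a) + L u) - f (L u))).
  by apply/funext => h /=; rewrite (linearP L).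
have [L0|[b Lb]] := HL a.
  have D0 u : derivable (f \o L) u (delta_mx 0 a).
    by have := @derivable0 _ _ _ f (L u); rewrite /derivable -L0 /= E.
  split=> [//|]; rewrite [pd _ _](_ : _ = fun=> 0); first exact: Ck_cst.
  apply/funext => u; have := @derive0 _ _ _ f (L u).
  by rewrite /pd /derive -L0 /= E.
have [D1 D2] := Df b; split=> [u Uu|].
  by have := D1 _ Uu; rewrite /derivable -Lb /= E.
rewrite [pd _ _](_ : _ = pd b f \o L); first exact: IH.
by apply/funext => u; rewrite /pd /= /derive -Lb /= E.
Qed.

Lemma lsubmx_delta (R : realType) d1 d2 (a : 'I_(d1 + d2)) :
  lsubmx (delta_mx 0 a : 'rV[R]_(d1 + d2)) = 0 \/
  exists b, lsubmx (delta_mx 0 a : 'rV[R]_(d1 + d2)) = delta_mx 0 b.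
Proof.
case: (split_ordP a) => j ->; [right; exists j|left];
  apply/rowP => i; rewrite !mxE; first by rewrite eq_lshift.
by rewrite eq_lrshift andbF.
Qed.

Lemma rsubmx_delta (R : realType) d1 d2 (a : 'I_(d1 + d2)) :
  rsubmx (delta_mx 0 a : 'rV[R]_(d1 + d2)) = 0 \/
  exists b, rsubmx (delta_mx 0 a : 'rV[R]_(d1 + d2)) = delta_mx 0 b.
Proof.
case: (split_ordP a) => j ->; [left|right; exists j];
  apply/rowP => i; rewrite !mxE; last by rewrite eq_rshift.
by rewrite eq_rlshift andbF.
Qed.

Section Product.
Variables (R : realType) (d1 d2 : nat) (M1 : manifold R d1) (M2 : manifold R d2).

Let pt : Type := (M1 * M2)%type.
Let ch : countType := (chart M1 * chart M2)%type.

Definition prod_dom (i : ch) : set pt :=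
  [set x | dom i.1 x.1 /\ dom i.2 x.2].
Definition prod_coord (i : ch) (x : pt) : 'rV[R]_(d1 + d2) :=
  row_mx (coord i.1 x.1) (coord i.2 x.2).
Definition prod_param (i : ch) (w : 'rV[R]_(d1 + d2)) : pt :=
  (param i.1 (lsubmx w), param i.2 (rsubmx w)).

Lemma prod_coordK i x : prod_dom i x -> prod_param i (prod_coord i x) = x.
Proof.
case: x => x1 x2 [/= h1 h2].
by rewrite /prod_param /prod_coord row_mxKl row_mxKr /= !coordK.
Qed.

Lemma prod_cover x : exists i, prod_dom i x.
Proof.
have [i1 h1] := dom_cover x.1; have [i2 h2] := dom_cover x.2.
by exists (i1, i2).
Qed.

Lemma prod_overlapE i j : prod_coord i @` (prod_dom i `&` prod_dom j) =
  (lsubmx @^-1` (coord i.1 @` (dom i.1 `&` dom j.1))) `&`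
  (rsubmx @^-1` (coord i.2 @` (dom i.2 `&` dom j.2))).
Proof.
apply/seteqP; split=> [w [[x1 x2] [[/= a1 a2] [/= b1 b2]] <-]|w].
  by rewrite /prod_coord /=; split; rewrite /= ?row_mxKl ?row_mxKr;
    [exists x1|exists x2].
move=> [[x1 [a1 b1] e1] [x2 [a2 b2] e2]]; exists (x1, x2) => //=.
by rewrite /prod_coord /= e1 e2 hsubmxK.
Qed.

Lemma prod_overlap_open i j :
  open (prod_coord i @` (prod_dom i `&` prod_dom j)).
Proof.
rewrite prod_overlapE; apply: openI; apply: open_comp;
  do ?exact: overlap_open; move=> w _.
- exact: continuous_lsubmx.
- exact: continuous_rsubmx.
Qed.

Lemma prod_transition i j b :
  smooth_on (prod_coord i @` (prod_dom i `&` prod_dom j))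
            (fun w => prod_coord j (prod_param i w) 0 b).
Proof.
move=> k; rewrite prod_overlapE; case: (split_ordP b) => c ->.
  apply: (@Ck_subset _ _ _ (lsubmx @^-1` (coord i.1 @` (dom i.1 `&` dom j.1)))).
    by move=> w [].
  rewrite (_ : (fun _ => _) =
    (fun u => coord j.1 (param i.1 u) 0 c) \o lsubmx); last first.
    by apply/funext => w; rewrite /prod_coord row_mxEl.
  apply: Ck_comp_linear; last exact: transition_smooth.
  - exact: continuous_lsubmx.
  - exact: lsubmx_delta.
apply: (@Ck_subset _ _ _ (rsubmx @^-1` (coord i.2 @` (dom i.2 `&` dom j.2)))).
  by move=> w [].
rewrite (_ : (fun _ => _) =
  (fun u => coord j.2 (param i.2 u) 0 c) \o rsubmx); last first.
  by apply/funext => w; rewrite /prod_coord row_mxEr.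
apply: Ck_comp_linear; last exact: transition_smooth.
- exact: continuous_rsubmx.
- exact: rsubmx_delta.
Qed.

Lemma prod_hausdorff x y : x <> y ->
  exists i j (A B : set 'rV[R]_(d1 + d2)),
  [/\ open A /\ open B,
      prod_dom i x /\ A (prod_coord i x),
      prod_dom j y /\ B (prod_coord j y) &
      forall z, prod_dom i z -> prod_dom j z ->
        A (prod_coord i z) -> B (prod_coord j z) -> False].
Proof.
case: x y => [x1 x2] [y1 y2] xy.
have op_l (A : set 'rV[R]_d1) : open A ->
    open (lsubmx @^-1` A : set 'rV[R]_(d1 + d2)).
  by move=> oA; apply: open_comp => // w _; exact: continuous_lsubmx.
have op_r (A : set 'rV[R]_d2) : open A ->
    open (rsubmx @^-1` A : set 'rV[R]_(d1 + d2)).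
  by move=> oA; apply: open_comp => // w _; exact: continuous_rsubmx.
have [e1|n1] := pselect (x1 = y1).
  have n2 : x2 <> y2 by move=> e2; apply: xy; rewrite e1 e2.
  have [i [j [A [B [[oA oB] [ix Ax] [jy By] AB]]]]] := hausdorff n2.
  have [i1 hx1] := dom_cover x1; have [j1 hy1] := dom_cover y1.
  exists (i1, i), (j1, j), (rsubmx @^-1` A), (rsubmx @^-1` B).
  split; do ?[by split; exact: op_r
             |by rewrite /prod_coord /prod_dom /= row_mxKr].
  move=> [z1 z2] [/= _ iz] [/= _ jz]; rewrite /prod_coord /= !row_mxKr.
  exact: AB.
have [i [j [A [B [[oA oB] [ix Ax] [jy By] AB]]]]] := hausdorff n1.
have [i2 hx2] := dom_cover x2; have [j2 hy2] := dom_cover y2.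
exists (i, i2), (j, j2), (lsubmx @^-1` A), (lsubmx @^-1` B).
split; do ?[by split; exact: op_l
           |by rewrite /prod_coord /prod_dom /= row_mxKl].
move=> [z1 z2] [/= iz _] [/= jz _]; rewrite /prod_coord /= !row_mxKl.
exact: AB.
Qed.

Definition prod_manifold : manifold R (d1 + d2) :=
  Manifold prod_coordK prod_cover prod_overlap_open prod_transition
    prod_hausdorff.

End Product.

Lemma rV_hausdorff (R : realType) d (x y : 'rV[R]_d) : x <> y ->
  exists A B : set 'rV[R]_d,
  [/\ open A /\ open B, A x, B y & forall z, A z -> B z -> False].
Proof.
move=> /eqP xy; have : hausdorff_space 'rV[R]_d by exact: norm_hausdorff.
rewrite open_hausdorff => /(_ _ _ xy)[[A B] /= [/set_mem Ax /set_mem By]].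
move=> [oA oB AB]; exists A, B; split=> // z Az Bz.
by have : (A `&` B) z by []; rewrite (eqP AB).
Qed.

Section GlobalChart.
Variables (R : realType) (d : nat) (T : Type).
Variables (f : T -> 'rV[R]_d) (g : 'rV[R]_d -> T).
Hypotheses (fK : cancel f g) (gK : cancel g f).

Let gdom (_ : unit) : set T := setT.
Let gcoord (_ : unit) := f.
Let gparam (_ : unit) := g.

Let goverlapE i j : gcoord i @` (gdom i `&` gdom j) = setT.
Proof. by apply/seteqP; split=> // u _; exists (g u). Qed.

Let gcoordK i x : gdom i x -> gparam i (gcoord i x) = x.
Proof. by move=> _; exact: fK. Qed.

Let gcover (x : T) : exists i, gdom i x.
Proof. by exists tt. Qed.

Let goverlap_open i j : open (gcoord i @` (gdom i `&` gdom j)).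
Proof. by rewrite goverlapE; exact: openT. Qed.

Let gtransition i j (b : 'I_d) :
  smooth_on (gcoord i @` (gdom i `&` gdom j))
            (fun u => gcoord j (gparam i u) 0 b).
Proof.
move=> k; rewrite [X in Ck _ _ X](_ : _ = fun u : 'rV[R]_d => u 0 b);
  first exact: Ck_coord.
by apply/funext => u; rewrite /gcoord /gparam gK.
Qed.

Let ghausdorff (x y : T) : x <> y ->
  exists i j (A B : set 'rV[R]_d),
  [/\ open A /\ open B,
      gdom i x /\ A (gcoord i x),
      gdom j y /\ B (gcoord j y) &
      forall z, gdom i z -> gdom j z ->
        A (gcoord i z) -> B (gcoord j z) -> False].
Proof.
move=> xy; have : f x <> f y by move=> /(can_inj fK).
move=> /rV_hausdorff [A [B [oAB Ax By AB]]].
by exists tt, tt, A, B; split=> // z _ _; exact: AB.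
Qed.

Definition global_chart_manifold : manifold R d :=
  Manifold gcoordK gcover goverlap_open gtransition ghausdorff.

End GlobalChart.

Lemma lineK (R : realType) :
  cancel (fun x : R => \row_(_ < 1) x) (fun u : 'rV[R]_1 => u 0 0).
Proof. by move=> x; rewrite mxE. Qed.

Lemma line_paramK (R : realType) :
  cancel (fun u : 'rV[R]_1 => u 0 0) (fun x : R => \row_(_ < 1) x).
Proof. by move=> u; apply/rowP => i; rewrite mxE ord1. Qed.

Definition line (R : realType) : manifold R 1 :=
  global_chart_manifold (@lineK R) (@line_paramK R).

Lemma one_pointK (R : realType) :
  cancel (fun _ : unit => 0 : 'rV[R]_0) (fun _ => tt).
Proof. by case. Qed.

Lemma one_point_paramK (R : realType) :
  cancel (fun _ => tt) (fun _ : unit => 0 : 'rV[R]_0).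
Proof. by move=> u; apply/rowP => -[]. Qed.

Definition one_point (R : realType) : manifold R 0 :=
  global_chart_manifold (@one_pointK R) (@one_point_paramK R).

(** The chart [b] of the sphere is the stereographic projection from the pole
    [(-1)^b e_0] of the unit sphere of R^(1+k) onto the hyperplane orthogonal
    to [e_0]. *)

Definition sqnorm (R : realType) (k : nat) (u : 'rV[R]_k) : R :=
  \sum_i u 0 i ^+ 2.

Definition sphere_point (R : realType) (k : nat) : Type :=
  {x : 'rV[R]_(1 + k) | sqnorm x == 1}.

Section Sphere.
Variables (R : realType) (k : nat).
Implicit Types (u : 'rV[R]_k) (b : bool) (x : sphere_point R k).

Definition height x : R := val x 0 0.

Definition sphere_dom b : set (sphere_point R k) :=
  [set x | height x != (-1) ^+ b].

Definition sphere_coord b x : 'rV[R]_k :=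
  (1 - (-1) ^+ b * height x)^-1 *: rsubmx (val x).

Definition stereo_inv b u : 'rV[R]_(1 + k) :=
  row_mx (\row_(_ < 1) ((-1) ^+ b * (sqnorm u - 1) / (sqnorm u + 1)))
         ((2 / (sqnorm u + 1)) *: u).

Lemma sqnorm_ge0 n (u : 'rV[R]_n) : 0 <= sqnorm u.
Proof. by apply: sumr_ge0 => i _; exact: sqr_ge0. Qed.

Lemma sqnorm_eq0 n (u : 'rV[R]_n) : sqnorm u = 0 -> u = 0.
Proof.
move=> /psumr_eq0P H; apply/rowP => i; rewrite mxE; apply/eqP.
by rewrite -sqrf_eq0; apply/eqP/H => // j _; exact: sqr_ge0.
Qed.

Lemma sqnorm1_gt0 n (u : 'rV[R]_n) : 0 < sqnorm u + 1.
Proof. by rewrite ltr_wpDl // sqnorm_ge0. Qed.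

Lemma sqnormZ n (c : R) (u : 'rV[R]_n) : sqnorm (c *: u) = c ^+ 2 * sqnorm u.
Proof.
by rewrite /sqnorm mulr_sumr; apply: eq_bigr => i _; rewrite mxE exprMn.
Qed.

Lemma sqnorm_split (x : 'rV[R]_(1 + k)) :
  sqnorm x = x 0 0 ^+ 2 + sqnorm (rsubmx x).
Proof.
rewrite /sqnorm big_ord_recl; congr (_ + _); apply: eq_bigr => i _.
by rewrite mxE; congr (x _ _ ^+ 2); apply: val_inj.
Qed.

Lemma stereo_inv0 b u :
  stereo_inv b u 0 0 = (-1) ^+ b * (sqnorm u - 1) / (sqnorm u + 1).
Proof.
rewrite /stereo_inv (_ : 0 = lshift k (0 : 'I_1)); last exact: val_inj.
by rewrite row_mxEl mxE.
Qed.

Lemma stereo_inv_sphere b u : sqnorm (stereo_inv b u) == 1.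
Proof.
rewrite sqnorm_split stereo_inv0 /stereo_inv row_mxKr sqnormZ.
have s0 : sqnorm u + 1 != 0 by rewrite gt_eqF // sqnorm1_gt0.
by apply/eqP; case: b; rewrite ?expr1 ?expr0; field.
Qed.

Definition sphere_param b u : sphere_point R k :=
  exist _ (stereo_inv b u) (stereo_inv_sphere b u).

Lemma height_param b u :
  height (sphere_param b u) = (-1) ^+ b * (sqnorm u - 1) / (sqnorm u + 1).
Proof. exact: stereo_inv0. Qed.

Lemma sphere_eq x : height x ^+ 2 + sqnorm (rsubmx (val x)) = 1.
Proof. by have /eqP := valP x; rewrite sqnorm_split. Qed.

Lemma sphere_den b x : sphere_dom b x -> 1 - (-1) ^+ b * height x != 0.
Proof.
rewrite /sphere_dom /=; apply: contraNN; rewrite subr_eq0 => /eqP H.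
by rewrite -[height x](signrMK b) -H mulr1.
Qed.

Lemma sqnorm_coord b x : sphere_dom b x ->
  sqnorm (sphere_coord b x) =
  (1 + (-1) ^+ b * height x) / (1 - (-1) ^+ b * height x).
Proof.
move=> /sphere_den h; rewrite /sphere_coord sqnormZ.
have -> : sqnorm (rsubmx (val x)) = 1 - height x ^+ 2.
  by apply: (canRL (addrK _)); rewrite addrC sphere_eq.
by move: h; case: b; rewrite ?expr1 ?expr0 ?mul1r ?mulN1r ?opprK => h; field.
Qed.

Lemma sphere_coordK b x :
  sphere_dom b x -> sphere_param b (sphere_coord b x) = x.
Proof.
move=> bx; apply: val_inj => /=; have h := sphere_den bx.
rewrite -[RHS]hsubmxK /stereo_inv sqnorm_coord //.
have e : (1 + (-1) ^+ b * height x) / (1 - (-1) ^+ b * height x) + 1 =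
    2 / (1 - (-1) ^+ b * height x) by field.
congr row_mx.
  apply/rowP => i; rewrite !mxE ord1.
  have -> : val x 0 (lshift k 0) = height x.
    by congr (val x _ _); apply: val_inj.
  by rewrite e; move: h {e}; case: b bx => bx;
    rewrite ?expr1 ?expr0 ?mul1r ?mulN1r ?opprK => h; field.
rewrite e scalerA -[RHS]scale1r; congr (_ *: _).
by field; rewrite h.
Qed.

Lemma sphere_dom_param b u : sphere_dom b (sphere_param b u).
Proof.
have s0 := sqnorm1_gt0 u; rewrite /sphere_dom /= height_param -subr_eq0.
have -> : (-1) ^+ b * (sqnorm u - 1) / (sqnorm u + 1) - (-1) ^+ b =
    (-1) ^+ b * (- 2) / (sqnorm u + 1) by field; rewrite gt_eqF.
by rewrite !mulf_neq0 ?signr_eq0 ?oppr_eq0 ?pnatr_eq0 ?invr_eq0 ?gt_eqF.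
Qed.

Lemma sphere_coord_param b c u :
  sphere_coord c (sphere_param b u) =
  ((1 - (-1) ^+ c * ((-1) ^+ b * (sqnorm u - 1) / (sqnorm u + 1)))^-1 *
   (2 / (sqnorm u + 1))) *: u.
Proof. by rewrite /sphere_coord height_param row_mxKr scalerA. Qed.

Lemma sphere_paramK b u : sphere_coord b (sphere_param b u) = u.
Proof.
rewrite sphere_coord_param -[RHS]scale1r; congr (_ *: _).
have s0 := sqnorm1_gt0 u.
have s1 : sqnorm u + 1 != 0 by rewrite gt_eqF.
rewrite -!mulrA signrMK.
have -> : 1 - (sqnorm u - 1) / (sqnorm u + 1) = 2 / (sqnorm u + 1) by field.
by rewrite mulVf // mulf_neq0 ?pnatr_eq0 // invr_eq0.
Qed.

Lemma sphere_overlapE i j :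
  sphere_coord i @` (sphere_dom i `&` sphere_dom j) =
  if i == j then setT else [set u | sqnorm u != 0].
Proof.
have -> : sphere_coord i @` (sphere_dom i `&` sphere_dom j) =
    [set u | sphere_dom j (sphere_param i u)].
  apply/seteqP; split=> [u [x [ix jx] <-]|u ju] /=.
    by rewrite sphere_coordK.
  exists (sphere_param i u); last exact: sphere_paramK.
  by split=> //; exact: sphere_dom_param.
case: eqP => [->|/eqP ij]; apply/seteqP; split=> u //.
- by move=> _; exact: sphere_dom_param.
- rewrite /sphere_dom /= height_param; apply: contra_neq => ->.
  by rewrite !add0r divr1 mulrN1; case: i j ij => [] [] //= _;
    rewrite ?expr1 ?expr0 ?opprK.
- rewrite /sphere_dom /= height_param => s0; have s1 := sqnorm1_gt0 u.
  rewrite -subr_eq0.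
  have -> : (-1) ^+ i * (sqnorm u - 1) / (sqnorm u + 1) - (-1) ^+ j =
      (-1) ^+ i * (2 * sqnorm u) / (sqnorm u + 1).
    by case: i j ij => [] [] //= _; rewrite ?expr1 ?expr0; field;
      rewrite gt_eqF.
  by rewrite !mulf_neq0 ?signr_eq0 ?pnatr_eq0 ?invr_eq0 ?s0 // gt_eqF.
Qed.

Lemma Ck_sqnorm l U : open U -> Ck l U (@sqnorm R k).
Proof.
move=> oU; apply: Ck_sum => // i.
have := Ck_mul oU (Ck_coord l U i) (Ck_coord l U i).
by apply: Ck_ext => // u _; rewrite expr2.
Qed.

Lemma sqnorm_continuous : continuous (@sqnorm R k).
Proof. by move=> u; apply: Ck_cont (Ck_sqnorm 0 openT) _. Qed.

Lemma open_sqnorm_neq0 : open [set u : 'rV[R]_k | sqnorm u != 0].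
Proof.
rewrite (_ : [set _ | _] = @sqnorm R k @^-1` [set x | x != 0]) //.
by apply: open_comp; [move=> u _; exact: sqnorm_continuous|exact: open_neq].
Qed.

Lemma open_sqnorm_lt1 : open [set u : 'rV[R]_k | sqnorm u < 1].
Proof.
rewrite (_ : [set _ | _] = @sqnorm R k @^-1` [set x | x < 1]) //.
by apply: open_comp; [move=> u _; exact: sqnorm_continuous|exact: open_lt].
Qed.

Lemma sphere_overlap_open i j :
  open (sphere_coord i @` (sphere_dom i `&` sphere_dom j)).
Proof.
rewrite sphere_overlapE; case: eqP => _; first exact: openT.
exact: open_sqnorm_neq0.
Qed.

Lemma sphere_transition i j (b : 'I_k) :
  smooth_on (sphere_coord i @` (sphere_dom i `&` sphere_dom j))
            (fun u => sphere_coord j (sphere_param i u) 0 b).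
Proof.
move=> l; rewrite sphere_overlapE; case: eqP => [->|/eqP ij].
  by apply: Ck_ext (Ck_coord l setT b) => [|u _];
    [exact: openT|rewrite sphere_paramK].
have o := open_sqnorm_neq0.
have := Ck_mul o (Ck_inv o (fun u h => h) (Ck_sqnorm l o)) (Ck_coord l _ b).
apply: Ck_ext => // u /= s0; rewrite sphere_coord_param mxE; congr (_ * _).
have s1 : sqnorm u + 1 != 0 by rewrite gt_eqF // sqnorm1_gt0.
have -> : 1 - (-1) ^+ j * ((-1) ^+ i * (sqnorm u - 1) / (sqnorm u + 1)) =
    (2 * sqnorm u) / (sqnorm u + 1).
  by case: i j ij => [] [] //= _; rewrite ?expr1 ?expr0; field.
by field; rewrite s0 s1.
Qed.

Lemma sphere_domN b x : ~ sphere_dom b x -> height x = (-1) ^+ b.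
Proof. by move=> /negP/negPn/eqP. Qed.

Lemma sphere_domNN b x : ~ sphere_dom b x -> sphere_dom (~~ b) x.
Proof.
move=> /sphere_domN h; rewrite /sphere_dom /= h.
by case: b {h}; rewrite /= ?expr1 ?expr0; apply/eqP => e; lra.
Qed.

Lemma sphere_cover x : exists b, sphere_dom b x.
Proof.
have [h|/sphere_domNN h] := pselect (sphere_dom true x); first by exists true.
by exists false.
Qed.

Lemma sphere_pole b x : ~ sphere_dom b x -> sqnorm (sphere_coord (~~ b) x) = 0.
Proof.
move=> h; rewrite (sqnorm_coord (sphere_domNN h)) (sphere_domN h).
by case: b {h}; rewrite /= ?expr1 ?expr0 ?mulN1r ?mul1r ?subrr ?mul0r.
Qed.

Lemma sphere_hausdorff x y : x <> y ->
  exists i j (A B : set 'rV[R]_k),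
  [/\ open A /\ open B,
      sphere_dom i x /\ A (sphere_coord i x),
      sphere_dom j y /\ B (sphere_coord j y) &
      forall z, sphere_dom i z -> sphere_dom j z ->
        A (sphere_coord i z) -> B (sphere_coord j z) -> False].
Proof.
move=> xy.
have same b : sphere_dom b x -> sphere_dom b y ->
    exists i j (A B : set 'rV[R]_k),
    [/\ open A /\ open B,
        sphere_dom i x /\ A (sphere_coord i x),
        sphere_dom j y /\ B (sphere_coord j y) &
        forall z, sphere_dom i z -> sphere_dom j z ->
          A (sphere_coord i z) -> B (sphere_coord j z) -> False].
  move=> bx bz; have : sphere_coord b x <> sphere_coord b y.
    move=> /(congr1 (sphere_param b)).
    by rewrite (sphere_coordK bx) (sphere_coordK bz).
  move=> /rV_hausdorff [A [B [oAB Ax By AB]]].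
  by exists b, b, A, B; split=> // z _ _; exact: AB.
have poles b : ~ sphere_dom b x -> ~ sphere_dom (~~ b) y ->
    exists i j (A B : set 'rV[R]_k),
    [/\ open A /\ open B,
        sphere_dom i x /\ A (sphere_coord i x),
        sphere_dom j y /\ B (sphere_coord j y) &
        forall z, sphere_dom i z -> sphere_dom j z ->
          A (sphere_coord i z) -> B (sphere_coord j z) -> False].
  move=> bx by_; exists (~~ b), b, [set u | sqnorm u < 1], [set u | sqnorm u < 1].
  split.
  - by split; exact: open_sqnorm_lt1.
  - by split; [exact: sphere_domNN|rewrite /= sphere_pole].
  - have := sphere_domNN by_; have := sphere_pole by_; rewrite negbK => s0 ?.
    by split; rewrite //= s0.
  move=> z iz jz /=; rewrite !sqnorm_coord //.
  have := sphere_den iz; have := sphere_den jz.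
  have := sqnorm_ge0 (sphere_coord b z).
  have := sqnorm_ge0 (sphere_coord (~~ b) z).
  rewrite !sqnorm_coord //.
  set p := (1 + _) / _; set q := (1 + _) / _ => p0 q0 h1 h2 p1 q1.
  suff : p * q = 1 by nra.
  rewrite /p /q; move: h1 h2; case: (b); rewrite /= ?expr1 ?expr0 ?mul1r ?mulN1r ?opprK => h1 h2;
    by field; rewrite h1 h2.
have [tx|tx] := pselect (sphere_dom true x);
  have [ty|ty] := pselect (sphere_dom true y).
- exact: same tx ty.
- have [fx|fx] := pselect (sphere_dom false x).
    exact: same fx (sphere_domNN ty).
  exact: poles fx ty.
- have [fy|fy] := pselect (sphere_dom false y).
    exact: same (sphere_domNN tx) fy.
  exact: poles tx fy.
- exact: same (sphere_domNN tx) (sphere_domNN ty).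
Qed.

Definition sphere_manifold : manifold R k :=
  Manifold sphere_coordK sphere_cover sphere_overlap_open sphere_transition
    sphere_hausdorff.

End Sphere.

Fixpoint torus (R : realType) (j : nat) : manifold R j :=
  if j is j'.+1 then prod_manifold (sphere_manifold R 1) (torus R j')
  else one_point R.

(** A metric is given by its Gram matrix in each chart; tangent vectors at a
    point are represented by their coordinates (row vectors) in a chart. *)

Definition bilin (R : realType) (d : nat) (G : 'M[R]_d) (v w : 'rV[R]_d) : R :=
  (v *m G *m w^T) 0 0.

(* Row convention: a vector with coordinates [v] in the chart [i] has
   coordinates [v *m transition_jac i j u] in the chart [j]. *)
Definition transition_jac (R : realType) (d : nat) (M : manifold R d)
    (i j : chart M) (u : 'rV[R]_d) : 'M[R]_d :=
  \matrix_(a, b) pd a (fun v => coord j (param i v) 0 b) u.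

Record riemannian_metric (R : realType) (d : nat) (M : manifold R d) :=
  RiemannianMetric {
    gram :> chart M -> 'rV[R]_d -> 'M[R]_d;
    gram_smooth : forall i a b,
      smooth_on (chart_image i) (fun u => gram i u a b);
    gram_sym : forall i u, chart_image i u -> (gram i u)^T = gram i u;
    gram_pos : forall i u v,
      chart_image i u -> v != 0 -> 0 < bilin (gram i u) v v;
    gram_compat : forall i j x, dom i x -> dom j x ->
      gram i (coord i x) =
      transition_jac i j (coord i x) *m gram j (coord j x)
        *m (transition_jac i j (coord i x))^T
  }.

(* A C^1 curve on [0, 1] inside one chart, written in coordinates. Asking for
   differentiability on all of R avoids one-sided derivatives and is harmless,
   as a C^1 curve on [0, 1] extends to a C^1 curve on R. *)
Definition C1_arc (R : realType) (d : nat) (M : manifold R d) (i : chart M)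
    (c : R -> 'rV[R]_d) : Prop :=
  [/\ forall t, derivable c t 1,
      continuous (derive1 c) &
      forall t, 0 <= t <= 1 -> chart_image i (c t)].

Definition arc_length (R : realType) (d : nat) (M : manifold R d)
    (g : riemannian_metric M) (i : chart M) (c : R -> 'rV[R]_d) : R :=
  \int[lebesgue_measure]_(t in `[0, 1])
     Num.sqrt (bilin (g i (c t)) (derive1 c t) (derive1 c t)).

(* [path_length g x y l]: some piecewise C^1 curve from x to y has length l.
   Such a curve is a concatenation of arcs each lying in one chart (Lebesgue
   number lemma). *)
Inductive path_length (R : realType) (d : nat) (M : manifold R d)
    (g : riemannian_metric M) : M -> M -> R -> Prop :=
| path_nil x : path_length g x x 0
| path_cons i c y l : C1_arc i c -> path_length g (param i (c 1)) y l ->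
    path_length g (param i (c 0)) y (arc_length g i c + l).

Definition riemannian_dist (R : realType) (d : nat) (M : manifold R d)
    (g : riemannian_metric M) (x y : M) : \bar R :=
  ereal_inf [set l%:E | l in path_length g x y].

Definition complete_metric (R : realType) (d : nat) (M : manifold R d)
    (g : riemannian_metric M) : Prop :=
  forall s : nat -> M,
    (forall e : R, 0 < e -> exists N, forall k l, (N <= k)%N -> (N <= l)%N ->
       (riemannian_dist g (s k) (s l) < e%:E)%E) ->
    exists x : M,
      forall e : R, 0 < e -> exists N, forall k, (N <= k)%N ->
        (riemannian_dist g (s k) x < e%:E)%E.

Definition christoffel (R : realType) (d : nat) (G : 'rV[R]_d -> 'M[R]_d)
    (l i j : 'I_d) (u : 'rV[R]_d) : R :=
  2^-1 * \sum_a invmx (G u) l a *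
    (pd i (fun v => G v j a) u + pd j (fun v => G v i a) u
     - pd a (fun v => G v i j) u).

(* The [a]-th coordinate of R(d_i, d_j) d_l, for the convention
   R(X, Y) Z = D_X D_Y Z - D_Y D_X Z - D_[X, Y] Z. *)
Definition curvature_endo (R : realType) (d : nat) (G : 'rV[R]_d -> 'M[R]_d)
    (u : 'rV[R]_d) (i j l a : 'I_d) : R :=
  pd i (christoffel G a j l) u - pd j (christoffel G a i l) u
  + \sum_b (christoffel G a i b u * christoffel G b j l u
            - christoffel G a j b u * christoffel G b i l u).

(* R(x, y, z, w) = <R(x, y) w, z>, so that R(x, y, x, y) is the sectional
   curvature of the plane spanned by x and y if these are orthonormal. *)
Definition riemann (R : realType) (d : nat) (G : 'rV[R]_d -> 'M[R]_d)
    (u x y z w : 'rV[R]_d) : R :=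
  \sum_i \sum_j \sum_k \sum_l
    x 0 i * y 0 j * z 0 k * w 0 l *
    \sum_a curvature_endo G u i j l a * G u a k.

Definition orthonormal_basis (R : realType) (d : nat) (G : 'M[R]_d)
    (e : 'I_d -> 'rV[R]_d) : Prop :=
  forall p q, bilin G (e p) (e q) = (p == q)%:R.

(* C_m(e_1, ..., e_m), the first m vectors of the basis being e_1, ..., e_m; it
   does not depend on the vectors by which these are completed to a basis.
   Indices start at 0. *)
Definition frame_curvature (R : realType) (d m : nat)
    (G : 'rV[R]_d -> 'M[R]_d) (u : 'rV[R]_d) (e : 'I_d -> 'rV[R]_d) : R :=
  \sum_(p < d | (p < m)%N) \sum_(q < d | (p < q)%N)
    riemann G u (e p) (e q) (e p) (e q).

(* The infimum is a minimum: the set of orthonormal bases is compact. *)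
Definition intermediate_curvature (R : realType) (d m : nat)
    (G : 'rV[R]_d -> 'M[R]_d) (u : 'rV[R]_d) : \bar R :=
  ereal_inf [set (frame_curvature m G u e)%:E | e in orthonormal_basis (G u)].

(* The value of [intermediate_curvature] at [x] does not depend on the chart. *)
Definition uniformly_positive_intermediate_curvature (R : realType) (d : nat)
    (M : manifold R d) (m : nat) (g : riemannian_metric M) : Prop :=
  exists2 lam : R, 0 < lam &
    forall (x : M) (i : chart M), dom i x ->
      (lam%:E <= intermediate_curvature m (g i) (coord i x))%E.

(* Main.v *)
(** On the product of the sphere of dimension k = n - m, the flat torus of
    dimension j = m - 1 and the line with coordinate r, take the doubly warped
    metric dr^2 + e^(s r^2) g_T + e^(-r^2) g_S / (1 + s) with s = k / m.
    Its curvature operator is diagonal, and the sectional curvature of the planes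
    tangent to the sphere, (1 + s) e^(r^2) - r^2, dominates all the others.  If N
    is the orthogonal projection onto the complement of span(e_1, .., e_m), then
    2 C_m(e_1, .., e_m) = sum_(a,b) K_ab (1 - delta_ab - w_ab) with
    w_ab = N_aa N_bb - N_ab^2 >= 0 and sum w_ab = k^2 - k, so C_m is least when
    the e_p span the torus and line directions, where it equals
    s + k (j s - 2) r^2 / 2 >= s because j k >= 2 m.

    For completeness, r, the torus seen as a product of unit circles, and the
    unit sphere scaled by e^(-r^2 / 2) give globally Lipschitz functions which
    detect convergence; hence a Cauchy sequence converges in the coordinates of
    some chart, and coordinate segments bound the distance to the limit. *)

From mathcomp Require Import all_boot all_order all_algebra.
From mathcomp Require Import ring lra.
From mathcomp Require Import all_classical all_reals all_analysis.
Require Import Defs.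
Set Implicit Arguments.
Unset Strict Implicit.
Unset Printing Implicit Defensive.
Import Order.TTheory GRing.Theory Num.Theory.
Import numFieldNormedType.Exports.

(** With rate s for the torus, the frame spanning the torus and line directions has [C_m = k - j s +
    (k j s - k - j (j + 1) s^2 / 2) r^2]. The coefficient of [r^2] is a quadratic polynomial in s,
    largest at [s = k / (j + 1) = k / m]; its maximum [k (j s - 2) / 2] is nonnegative exactly when
    [j k >= 2 m]. The positive term [k j s r^2] comes from planes spanned by a sphere and a torus
    direction: their curvature is minus the product of the logarithmic derivatives [- r] and [s r]
    of the two warping factors, so one factor has to decrease while the other increases. The price
    is the curvature [1 - r^2] and [- s - s^2 r^2] of the planes containing the line.

    The divisor [1 + s] makes the spheres small enough for their planes to dominate: [e^x >= 1 + x]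
    gives [(1 + s) e^(r^2) - r^2 >= 1 + s + s r^2], which exceeds all the other curvatures.

    Stereographic coordinates make every factor conformally flat, so that one diagonal formula
    serves as Gram matrix in all charts and the curvature is computed only once. Moreover the image
    of every chart is the whole coordinate space. *)

(** * Rules for directional derivatives *)

Section DirectionalDerivatives.
Local Open Scope classical_set_scope.
Local Open Scope ring_scope.
Variables (R : realType) (V : normedModType R).
Implicit Types (f g : V -> R) (x v : V) (df dg : R).

Lemma is_derive_add f g x v df dg : is_derive x v f df -> is_derive x v g dg ->
  is_derive x v (fun y => f y + g y) (df + dg).
Proof. by move=> Hf Hg; exact: (is_deriveD Hf Hg). Qed.

Lemma is_derive_mul f g x v df dg : is_derive x v f df -> is_derive x v g dg ->
  is_derive x v (fun y => f y * g y) (df * g x + f x * dg).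
Proof.
move=> Hf Hg; apply: is_derive_eq (is_deriveM Hf Hg) _.
by rewrite addrC [df * _]mulrC.
Qed.

Lemma is_derive_inv f x v df : f x != 0 -> is_derive x v f df ->
  is_derive x v (fun y => (f y)^-1) (- df / f x ^+ 2).
Proof.
move=> fx Hf; have Df := @ex_derive _ _ _ _ _ _ _ Hf.
apply: DeriveDef; first exact: derivableV.
by rewrite deriveV // derive_val -[_ *: _]/(_ * _) mulNr mulrC mulNr.
Qed.

Lemma is_derive_fsum (I : finType) (F : I -> V -> R) (dF : I -> R) x v :
  (forall i, is_derive x v (F i) (dF i)) ->
  is_derive x v (fun y => \sum_i F i y) (\sum_i dF i).
Proof.
move=> HF.
rewrite [X in is_derive _ _ X _](_ : _ = \sum_(i <- index_enum I) F i); last first.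
  by apply/funext => y; rewrite fct_sumE.
elim: (index_enum I) => [|i s IH]; first by rewrite !big_nil; exact: is_derive_cst.
by rewrite !big_cons; exact: is_deriveD.
Qed.

Lemma is_derive_entry n (c : V -> 'rV[R]_n) x v (w : 'rV[R]_n) b :
  is_derive x v c w -> is_derive x v (fun y => c y 0 b) (w 0 b).
Proof.
move=> Hc; have Dc := @ex_derive _ _ _ _ _ _ _ Hc.
have Db : derivable (fun y => c y 0 b) x v by exact: (derivable_mxP c x v).1.
apply: DeriveDef => //.
by rewrite -[w](@derive_val _ _ _ _ _ _ _ Hc) (derive_mx Dc) mxE.
Qed.

(** A derivative along [v] at [x] is the derivative at 0 of [t => f (t *: v + x)], which reduces the
    claim to the chain rule in one variable. *)
Lemma is_derive_expR_comp f x v df : is_derive x v f df ->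
  is_derive x v (fun y => expR (f y)) (expR (f x) * df).
Proof.
move=> Hf; have Df := @ex_derive _ _ _ _ _ _ _ Hf.
have key (h : V -> R) : 'D_v h x = 'D_(1 : R) (fun t : R => h (t *: v + x)) 0.
  rewrite /derive; set g1 := fun t => t^-1 *: _; set g2 := fun t => t^-1 *: _.
  suff -> : g1 = g2 by [].
  by apply/funext => t; rewrite /g1 /g2 /= addr0 scale0r add0r [_%:A]mulr1.
have H1 : is_derive (0 : R) (1 : R) (fun t : R => f (t *: v + x)) df.
  apply: DeriveDef; first by have := (derivable1P f x v).1 Df.
  by rewrite -key; exact: (@derive_val _ _ _ _ _ _ _ Hf).
have H2 : is_derive (f ((0:R) *: v + x)) 1 expR (expR (f ((0:R) *: v + x))).
  exact: is_derive_expR.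
have H3 := is_derive1_comp H2 H1.
rewrite scale0r add0r in H3.
apply: DeriveDef; last by rewrite key; exact: (@derive_val _ _ _ _ _ _ _ H3).
by apply: (derivable1P _ x v).2; exact: (@ex_derive _ _ _ _ _ _ _ H3).
Qed.

Lemma is_derive_ext f g x v df : f =1 g -> is_derive x v f df -> is_derive x v g df.
Proof. by move=> /funext ->. Qed.

Lemma is_derive_sqr f x v df : is_derive x v f df ->
  is_derive x v (fun y => f y ^+ 2) (2 * f x * df).
Proof.
move=> Hf; apply: is_derive_eq (is_derive_mul Hf Hf) _; ring.
Qed.

Lemma is_derive_scale a f x v df : is_derive x v f df ->
  is_derive x v (fun y => a * f y) (a * df).
Proof.
move=> Hf; apply: is_derive_eq (is_derive_mul (is_derive_cst a x v) Hf) _.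
by rewrite mul0r add0r.
Qed.

Lemma is_derive_opp f x v df : is_derive x v f df ->
  is_derive x v (fun y => - f y) (- df).
Proof. by move=> Hf; exact: is_deriveN. Qed.

End DirectionalDerivatives.

(** * Curvature of a diagonal metric *)

Ltac simp_eq := repeat match goal with
  H : is_true (?x != ?y) |- context [?x == ?y] => rewrite (negPf H) end;
  rewrite ?eqxx ?mulr1n ?mulr0n ?mul0r ?mul1r ?subr0 ?add0r ?addr0.

Section DiagonalMetric.
Local Open Scope classical_set_scope.
Local Open Scope ring_scope.
Variables (R : realType) (d : nat).
(* If [g b = exp (2 f_b)], then [p a b] and [q c a b] are the first and second
   partial derivatives of [f_b]. *)
Variable g : 'I_d -> 'rV[R]_d -> R.
Variable p : 'I_d -> 'I_d -> 'rV[R]_d -> R.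
Variable q : 'I_d -> 'I_d -> 'I_d -> 'rV[R]_d -> R.
Hypothesis g_gt0 : forall b u, 0 < g b u.
Hypothesis g_derive : forall a b u,
  is_derive u (delta_mx 0 a) (g b) (2 * p a b u * g b u).
Hypothesis p_derive : forall c a b u,
  is_derive u (delta_mx 0 c) (p a b) (q c a b u).

Definition diag_metric (u : 'rV[R]_d) : 'M[R]_d := diag_mx (\row_b g b u).

Let g_neq0 b u : g b u != 0. Proof. by rewrite gt_eqF. Qed.

Lemma diag_metricE u a b : diag_metric u a b = (a == b)%:R * g a u.
Proof. by rewrite /diag_metric !mxE mulr_natl. Qed.

Lemma sum_delta (I : finType) (F : I -> R) a : \sum_b (b == a)%:R * F b = F a.
Proof.
rewrite (bigD1 a) //= eqxx mul1r big1 ?addr0 // => b /negPf ->.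
by rewrite mul0r.
Qed.

Lemma invmx_diag_metric u : invmx (diag_metric u) = diag_mx (\row_b (g b u)^-1).
Proof.
set B := diag_mx _.
have AB : diag_metric u *m B = 1%:M.
  rewrite /diag_metric /B mulmx_diag -diag_const_mx; congr diag_mx.
  by apply/rowP => i; rewrite !mxE mulfV.
have [uA _] := mulmx1_unit AB.
by rewrite -[LHS]mulmx1 -AB mulmxA mulVmx // mul1mx.
Qed.

Lemma pd_diag_metric c a b u :
  pd c (fun v => diag_metric v a b) u = (a == b)%:R * (2 * p c a u * g a u).
Proof.
rewrite /pd; apply: derive_val.
apply: is_derive_ext (is_derive_scale _ (g_derive c a u)).
by move=> v; rewrite diag_metricE.
Qed.

Lemma christoffel_diag l i j u : christoffel diag_metric l i j u =
  (l == j)%:R * p i l u + (l == i)%:R * p j l u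
  - (i == j)%:R * (p l i u * (g i u / g l u)).
Proof.
rewrite /christoffel (bigD1 l) //= big1 ?addr0; last first.
  move=> a /negPf al; rewrite invmx_diag_metric !mxE eq_sym al mulr0n.
  by rewrite !mul0r.
rewrite invmx_diag_metric !pd_diag_metric !mxE eqxx mulr1n.
have := g_neq0 l u; rewrite ![l == _]eq_sym.
case: (eqVneq j l) => [->|jl]; case: (eqVneq i l) => [->|il];
  rewrite /= ?mul1r ?mul0r; case: (eqVneq i j) => ij; subst;
  rewrite ?eqxx ?(negPf jl) //= => h; try field; rewrite ?h ?g_neq0 //.
Qed.

(** The derivative of the right-hand side of [christoffel_diag]. The ratio [g i / g l] has
    logarithmic derivative [2 (p c i - p c l)], so no new function appears. *)
Let dchr c l i j u : R :=
  (l == j)%:R * q c i l u + (l == i)%:R * q c j l u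
  - (i == j)%:R * ((q c l i u + 2 * p l i u * (p c i u - p c l u)) *
       (g i u / g l u)).

Lemma pd_christoffel_diag c l i j u :
  pd c (christoffel diag_metric l i j) u = dchr c l i j u.
Proof.
rewrite /pd; apply: derive_val.
have E : (fun v => (l == j)%:R * p i l v + (l == i)%:R * p j l v +
  - ((i == j)%:R * (p l i v * (g i v * (g l v)^-1)))) =1
  christoffel diag_metric l i j by move=> v; rewrite christoffel_diag.
apply: is_derive_ext E _.
have H1 := is_derive_mul (g_derive c i u) (is_derive_inv (g_neq0 l u) (g_derive c l u)).
have H2 := is_derive_scale (i == j)%:R (is_derive_mul (p_derive c l i u) H1).
have H3 := is_derive_add (is_derive_scale (l == j)%:R (p_derive c i l u))
  (is_derive_scale (l == i)%:R (p_derive c j l u)).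
apply: is_derive_eq (is_derive_add H3 (is_derive_opp H2)) _.
rewrite /dchr; congr (_ + _ - _ * _); field; exact: g_neq0.
Qed.

(** The inner product of the gradients of [f_i] and [f_j], where [g b = exp (2 f_b)]. *)
Definition grad_dot i j u : R := \sum_b p b i u * p b j u / g b u.

(** Of the three terms of [christoffel a i b], one forces [b = a] and one forces [b = i]. Only the
    middle one, present for [a = i], keeps a sum over [b]; its part with [j = l] is the inner
    product of gradients. *)
Lemma sum_christoffel_diag a i j l u :
  \sum_b christoffel diag_metric a i b u * christoffel diag_metric b j l u =
  p i a u * christoffel diag_metric a j l u
  + (a == i)%:R * (p l a u * p j l u + p j a u * p l j u
                   - (j == l)%:R * (g j u * grad_dot a j u))
  - p a i u * (g i u / g a u) * christoffel diag_metric i j l u.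
Proof.
under eq_bigr do rewrite [christoffel _ a i _ _]christoffel_diag.
under eq_bigr do rewrite mulrBl mulrDl.
rewrite sumrB big_split /=; congr (_ + _ - _).
- rewrite -(sum_delta (fun b => p i a u * christoffel diag_metric b j l u) a).
  by apply: eq_bigr => b _; rewrite [_ == b]eq_sym; case: eqVneq => [->|_] /=; ring.
- rewrite (eq_bigr (fun b => (a == i)%:R * ((b == l)%:R * (p b a u * p j b u) +
    (b == j)%:R * (p b a u * p l b u) - 
    (j == l)%:R * (g j u * (p b a u * p b j u / g b u))))); last first.
    by move=> b _; rewrite christoffel_diag; field; exact: g_neq0.
  rewrite -mulr_sumr sumrB big_split /= !sum_delta; congr (_ * (_ + _ - _)).
  by rewrite -!mulr_sumr.
- rewrite -(sum_delta
    (fun b => p a i u * (g i u / g a u) * christoffel diag_metric b j l u) i).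
  by apply: eq_bigr => b _; rewrite [_ == b]eq_sym; case: eqVneq => [->|_] /=; ring.
Qed.

Hypothesis q_sym : forall c a b u, q c a b u = q a c b u.
(* Vanishing of the curvature components R_(i j i l) with i, j, l distinct. *)
Hypothesis q_offdiag : forall i j l u, i != j -> i != l -> j != l ->
  q j l i u = p l i u * p j l u + p j i u * p l j u - p j i u * p l i u.

(** The sectional curvature of the coordinate plane of [i] and [j], by [curvature_endo_diag]. For
    [i = j] the formula is not a curvature; it then occurs only with coefficient 0. *)
Definition sec_curv i j u : R :=
  - (q i i j u + p i j u ^+ 2 - 2 * p i j u * p i i u) / g i u
  - (q j j i u + p j i u ^+ 2 - 2 * p j i u * p j j u) / g j u
  - grad_dot i j u.

Lemma grad_dot_sym i j u : grad_dot i j u = grad_dot j i u.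
Proof. by apply: eq_bigr => b _; rewrite [p b i u * _]mulrC. Qed.

Lemma sec_curv_sym i j u : sec_curv i j u = sec_curv j i u.
Proof. by rewrite /sec_curv grad_dot_sym; ring. Qed.

(** By cases on the coincidences between the indices. With four distinct indices all Kronecker
    symbols vanish; with three, the component vanishes by [q_offdiag], or by the symmetry of second
    derivatives when [a = l]. What remains lies in the plane of [i] and [j] and gives [sec_curv]. *)
Lemma curvature_endo_diag u i j l a : curvature_endo diag_metric u i j l a =
  sec_curv i j u * ((a == i)%:R * (j == l)%:R * g j u
                    - (a == j)%:R * (i == l)%:R * g i u).
Proof.
rewrite /curvature_endo !pd_christoffel_diag sumrB !sum_christoffel_diag.
rewrite !christoffel_diag /dchr /sec_curv.
have gn b := g_neq0 b u.
have [->|ij] := eqVneq i j.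
  rewrite [X in _ = X](_ : _ = 0); first by ring.
  by ring.
have ji : j != i by rewrite eq_sym.
have [->|ai] := eqVneq a i; first last.
  have ia : i != a by rewrite eq_sym.
  have [->|aj] := eqVneq a j; first last.
    have ja : j != a by rewrite eq_sym.
    have [->|li] := eqVneq l i.
      by simp_eq; rewrite (q_offdiag u ij ia ja);field; rewrite !gn.
    have il : i != l by rewrite eq_sym.
    have [->|lj] := eqVneq l j.
      by simp_eq; rewrite (q_offdiag u ji ja ia); field; rewrite !gn.
    have jl : j != l by rewrite eq_sym.
    have [->|la] := eqVneq l a; simp_eq; last by field; rewrite ?gn.
    by rewrite (q_sym i j a); field; rewrite !gn.
  have [->|li] := eqVneq l i.
    by simp_eq; rewrite (grad_dot_sym i j); field; rewrite !gn.
  have il : i != l by rewrite eq_sym.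
  have [->|lj] := eqVneq l j.
    by simp_eq; rewrite ?(q_sym i j j); field; rewrite !gn.
  have jl : j != l by rewrite eq_sym.
  by simp_eq; rewrite (q_offdiag u ji jl il); field; rewrite ?gn.
have [->|li] := eqVneq l i.
  by simp_eq; rewrite ?(q_sym i j i); field; rewrite !gn.
have il : i != l by rewrite eq_sym.
have [->|lj] := eqVneq l j.
  by simp_eq; rewrite (grad_dot_sym i j); field; rewrite !gn.
have jl : j != l by rewrite eq_sym.
by simp_eq; rewrite (q_offdiag u ij il jl); field; rewrite ?gn.
Qed.
End DiagonalMetric.

(** * Intermediate curvature of a diagonal curvature operator *)

Section FrameCurvature.
Local Open Scope ring_scope.
Variables (R : realType) (d : nat).

Lemma sum_pairs_sym (F : 'I_d -> 'I_d -> R) :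
  (forall p q, F p q = F q p) -> (forall p, F p p = 0) ->
  \sum_(p < d) \sum_q F p q = 2 * \sum_(p < d) \sum_(q < d | (p < q)%N) F p q.
Proof.
move=> Fsym F0.
have E p : \sum_q F p q =
    \sum_(q < d | (p < q)%N) F p q + \sum_(q < d | (q < p)%N) F p q.
  rewrite (bigID (fun q : 'I_d => (p < q)%N)) /=; congr (_ + _).
  rewrite (bigID (fun q : 'I_d => q == p)) /= big1 ?add0r; last first.
    by move=> q /andP[_ /eqP ->].
  by apply: eq_bigl => q; rewrite -leqNgt [RHS]ltn_neqAle andbC.
under eq_bigr do rewrite E.
rewrite big_split /= mulr_natl mulr2n; congr (_ + _).
rewrite (exchange_big_dep xpredT) //=; apply: eq_bigr => p _.
by apply: eq_bigr => q _.
Qed.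

(** A pair [p < q] fails to have [p < m] exactly when both indices are at least [m]. *)
Lemma sum_first_pairs (m : nat) (F : 'I_d -> 'I_d -> R) :
  (forall p q, F p q = F q p) -> (forall p, F p p = 0) ->
  2 * \sum_(p < d | (p < m)%N) \sum_(q < d | (p < q)%N) F p q =
  \sum_(p < d) \sum_q F p q
  - \sum_(p < d | (m <= p)%N) \sum_(q < d | (m <= q)%N) F p q.
Proof.
move=> Fsym F0.
pose H (p q : 'I_d) := ((m <= p) && (m <= q))%N%:R * F p q.
have -> : \sum_(p < d | (m <= p)%N) \sum_(q < d | (m <= q)%N) F p q =
    \sum_(p < d) \sum_q H p q.
  rewrite big_mkcond; apply: eq_bigr => p _; rewrite /H.
  case: (m <= p)%N; last by rewrite big1 // => q _; rewrite mul0r.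
  rewrite big_mkcond; apply: eq_bigr => q _.
  by case: (m <= q)%N; rewrite /= ?mul1r ?mul0r.
rewrite !sum_pairs_sym //; first last.
- by move=> p; rewrite /H F0 mulr0.
- by move=> p q; rewrite /H Fsym andbC.
rewrite -mulrBr; congr (_ * _); rewrite big_mkcond -sumrB; apply: eq_bigr => p _.
rewrite -sumrB; case: ltnP => pm; last first.
  rewrite big1 // => q pq; rewrite /H pm (leq_trans pm (ltnW pq)) /= mul1r.
  by rewrite subrr.
by apply: eq_bigr => q _; rewrite /H leqNgt pm /= mul0r subr0.
Qed.

(** The rows of [X] are the vectors of an orthonormal frame, written in an orthonormal basis whose
    coordinate planes diagonalise the curvature operator, with eigenvalues [K i j]. *)
Variable X : 'M[R]_d.
Hypothesis X_orth : X *m X^T = 1%:M.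

Let rowsE p q : \sum_i X p i * X q i = (p == q)%:R.
Proof.
have := congr1 (fun A : 'M[R]_d => A p q) X_orth; rewrite !mxE => <-.
by apply: eq_bigr => i _; rewrite mxE.
Qed.

Let colsE i j : \sum_(p < d) X p i * X p j = (i == j)%:R.
Proof.
have := congr1 (fun A : 'M[R]_d => A i j) (mulmx1C X_orth); rewrite !mxE => <-.
by apply: eq_bigr => p _; rewrite mxE.
Qed.

Variable K : 'I_d -> 'I_d -> R.

(** The sectional curvature of the plane spanned by rows [p] and [q]: for symmetric [K], the sum
    over [i < j] of [K i j] times the squared Plücker coordinate of that plane. *)
Let sec p q := \sum_i \sum_j K i j *
  (X p i ^+ 2 * X q j ^+ 2 - X p i * X p j * (X q i * X q j)).

(** The matrix of the orthogonal projection onto the span of the rows in [P]; its principal minors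
    of size 2, defined next, are the [w_ab] of the overview. *)
Let proj (P : pred 'I_d) i j := \sum_(p | P p) X p i * X p j.

Let minor P i j := proj P i i * proj P j j - proj P i j ^+ 2.

Let sum_sec P : \sum_(p | P p) \sum_(q | P q) sec p q =
  \sum_i \sum_j K i j * minor P i j.
Proof.
rewrite /sec.
under eq_bigr do rewrite exchange_big /=.
rewrite exchange_big /=; apply: eq_bigr => i _.
under eq_bigr do rewrite exchange_big /=.
rewrite exchange_big /=; apply: eq_bigr => j _.
under eq_bigr do rewrite -mulr_sumr.
rewrite -mulr_sumr; congr (_ * _); rewrite /minor /proj expr2 !mulr_suml -sumrB.
apply: eq_bigr => p _; rewrite !mulr_sumr -sumrB; apply: eq_bigr => q _.
by rewrite !expr2.
Qed.

(** Lagrange's identity writes twice the minor as a sum of squares. *)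
Let minor_ge0 P i j : 0 <= minor P i j.
Proof.
have : 2 * minor P i j =
    \sum_(p | P p) \sum_(q | P q) (X p i * X q j - X p j * X q i) ^+ 2.
  have -> : 2 * minor P i j = proj P i i * proj P j j + proj P j j * proj P i i
      - 2 * (proj P i j * proj P i j) by rewrite /minor; ring.
  rewrite /proj !mulr_suml mulr_sumr -big_split -sumrB /=.
  apply: eq_bigr => p _; rewrite !mulr_sumr -big_split -sumrB /=.
  by apply: eq_bigr => q _; ring.
move=> E; rewrite -(pmulr_rge0 _ (ltr0Sn R 1)) E.
by do 2![apply: sumr_ge0 => ? _]; exact: sqr_ge0.
Qed.

(** The sum is [(tr N)^2 - tr (N^2)] for a symmetric idempotent [N] of rank [#|P|]. *)
Let sum_minor P : \sum_i \sum_j minor P i j = #|P|%:R ^+ 2 - #|P|%:R.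
Proof.
have trE : \sum_i proj P i i = #|P|%:R.
  rewrite /proj exchange_big /= (eq_bigr (fun=> 1)); last first.
    by move=> p _; rewrite rowsE eqxx.
  by rewrite sumr_const.
have sqE : \sum_i \sum_j proj P i j ^+ 2 = #|P|%:R.
  transitivity (\sum_(p | P p) \sum_(q | P q) (\sum_i X p i * X q i) ^+ 2).
    under eq_bigr do under eq_bigr do rewrite expr2 /proj mulr_suml.
    under eq_bigr do rewrite exchange_big /=.
    rewrite exchange_big /=; apply: eq_bigr => p _.
    under eq_bigr do under eq_bigr do rewrite mulr_sumr.
    under eq_bigr do rewrite exchange_big /=.
    rewrite exchange_big /=; apply: eq_bigr => q _.
    rewrite expr2 mulr_suml; apply: eq_bigr => i _.
    by rewrite mulr_sumr; apply: eq_bigr => j _; ring.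
  rewrite (eq_bigr (fun=> 1)); last first.
    move=> p Pp; rewrite (bigD1 p) //= rowsE eqxx expr1n big1 ?addr0 //.
    by move=> q /andP[_ qp]; rewrite rowsE eq_sym (negPf qp) expr0n.
  by rewrite sumr_const.
under eq_bigr do rewrite sumrB -mulr_sumr trE.
by rewrite sumrB sqE -mulr_suml trE expr2.
Qed.

(** Summed over all pairs of frame vectors, the curvatures give the scalar curvature, whatever the
    frame. The pairs to be removed lie in the span of the last [d - m] vectors and contribute the
    sum of [K i j] times nonnegative minors of known total. *)
Lemma frame_sum_ge (m : nat) (kap : R) (mle : (m <= d)%N) :
  (forall i j, i != j -> K i j <= kap) -> (forall i j, K i j = K j i) ->
  \sum_i \sum_(j | j != i) K i j - kap * ((d - m)%:R ^+ 2 - (d - m)%:R) <=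
  2 * \sum_(p < d | (p < m)%N) \sum_(q < d | (p < q)%N) sec p q.
Proof.
move=> Kle Ksym.
rewrite sum_first_pairs; first last.
- move=> p; rewrite /sec big1 // => i _; rewrite big1 // => j _.
  by rewrite (_ : _ - _ = 0) ?mulr0 //; ring.
- move=> p q; rewrite /sec exchange_big /=; apply: eq_bigr => i _.
  by apply: eq_bigr => j _; rewrite Ksym; ring.
pose P := [pred p : 'I_d | (m <= p)%N].
have cardP : #|P| = (d - m)%N.
  have cardPC : #|predC P| = m.
    rewrite -sum1_card -[RHS]card_ord -sum1_card (big_ord_widen _ (fun=> 1%N) mle).
    by apply: eq_bigl => i; rewrite !inE -ltnNge.
  by rewrite -[d in RHS]card_ord -(cardC P) cardPC addnK.
rewrite (sum_sec P) -cardP -(sum_minor P).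
(* For the full frame the projection is the identity, so its minors are 1 off the diagonal and 0 on
   it. *)
have -> : \sum_(p < d) \sum_q sec p q = \sum_i \sum_(j | j != i) K i j.
  rewrite (sum_sec xpredT); apply: eq_bigr => i _.
  rewrite [RHS]big_mkcond; apply: eq_bigr => j _; rewrite /minor /proj !colsE !eqxx.
  rewrite [i == j]eq_sym; case: (j == i); rewrite /= ?mulr1n ?mulr0n; ring.
rewrite lerD2l lerN2 mulr_sumr; apply: ler_sum => i _.
rewrite mulr_sumr; apply: ler_sum => j _.
have [->|ij] := eqVneq i j.
  by rewrite (_ : minor P j j = 0) ?mulr0 // /minor; ring.
by apply: ler_wpM2r; [exact: minor_ge0|exact: Kle].
Qed.

End FrameCurvature.

(** * Orthonormal frames of a diagonal metric *)

Section DiagonalFrame.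
Local Open Scope ring_scope.
Variables (R : realType) (d : nat).
Variable g : 'I_d -> 'rV[R]_d -> R.
Variable p : 'I_d -> 'I_d -> 'rV[R]_d -> R.
Variable q : 'I_d -> 'I_d -> 'I_d -> 'rV[R]_d -> R.
Hypothesis g_gt0 : forall b u, 0 < g b u.
Hypothesis g_derive : forall a b u,
  is_derive u (delta_mx 0 a) (g b) (2 * p a b u * g b u).
Hypothesis p_derive : forall c a b u,
  is_derive u (delta_mx 0 c) (p a b) (q c a b u).
Hypothesis q_sym : forall c a b u, q c a b u = q a c b u.
Hypothesis q_offdiag : forall i j l u, i != j -> i != l -> j != l ->
  q j l i u = p l i u * p j l u + p j i u * p l j u - p j i u * p l i u.

Lemma riemann_diag u x y : riemann (diag_metric g) u x y x y =
  \sum_i \sum_j sec_curv g p q i j u * (g i u * g j u) *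
    (x 0 i ^+ 2 * y 0 j ^+ 2 - x 0 i * x 0 j * (y 0 i * y 0 j)).
Proof.
rewrite /riemann; apply: eq_bigr => i _; apply: eq_bigr => j _.
set S := sec_curv _ _ _ _ _ _.
have inner k l : \sum_a curvature_endo (diag_metric g) u i j l a * diag_metric g u a k =
    S * (g i u * g j u) * ((k == i)%:R * (l == j)%:R - (k == j)%:R * (l == i)%:R).
  transitivity (\sum_a (a == k)%:R *
      (curvature_endo (diag_metric g) u i j l k * g k u)).
    apply: eq_bigr => a _; rewrite diag_metricE.
    by case: eqVneq => [->|_] /=; ring.
  rewrite sum_delta (curvature_endo_diag g_gt0 g_derive p_derive q_sym q_offdiag) -/S.
  rewrite [j == l]eq_sym [i == l]eq_sym.
  case: (eqVneq k i) => [->|_]; last case: (eqVneq k j) => [->|_].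
  - by case: (eqVneq i j) => [->|_]; rewrite /= ?mulr1n ?mulr0n; ring.
  - by rewrite /= ?mulr1n ?mulr0n; ring.
  - by rewrite /= ?mulr0n; ring.
under eq_bigr do under eq_bigr do rewrite inner.
pose c := x 0 i * y 0 j * (S * (g i u * g j u)).
transitivity (\sum_k ((k == i)%:R * (c * x 0 k * y 0 j) -
                      (k == j)%:R * (c * x 0 k * y 0 i))).
  apply: eq_bigr => k _.
  transitivity (\sum_l ((l == j)%:R * ((k == i)%:R * (c * x 0 k * y 0 l)) -
                        (l == i)%:R * ((k == j)%:R * (c * x 0 k * y 0 l)))).
    by apply: eq_bigr => l _; rewrite /c; ring.
  by rewrite sumrB !sum_delta.
by rewrite sumrB !sum_delta /c; ring.
Qed.

Lemma frame_curvature_diag_ge (m : nat) u (kap : R) (e : 'I_d -> 'rV[R]_d) :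
  (m <= d)%N -> orthonormal_basis (diag_metric g u) e ->
  (forall i j, i != j -> sec_curv g p q i j u <= kap) ->
  \sum_i \sum_(j | j != i) sec_curv g p q i j u
    - kap * ((d - m)%:R ^+ 2 - (d - m)%:R) <=
  2 * frame_curvature m (diag_metric g) u e.
Proof.
move=> md He Kle.
(* Scaling the coordinates by [Num.sqrt (g i u)] makes the coordinate basis orthonormal, so the
   frame becomes an orthogonal matrix. *)
pose X : 'M[R]_d := \matrix_(a, i) (e a 0 i * Num.sqrt (g i u)).
have X_orth : X *m X^T = 1%:M.
  apply/matrixP => a b; rewrite !mxE -(He a b) /bilin !mxE.
  apply: eq_bigr => i _; rewrite /diag_metric mul_mx_diag !mxE.
  rewrite mulrACA -expr2 sqr_sqrtr ?ltW //; ring.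
have := @frame_sum_ge _ _ X X_orth (fun i j => sec_curv g p q i j u) m kap md Kle
  (fun i j => sec_curv_sym g p q i j u).
congr (_ <= 2 * _); apply: eq_bigr => a _; apply: eq_bigr => b _.
rewrite riemann_diag; apply: eq_bigr => i _; apply: eq_bigr => j _.
rewrite !mxE.
have gi := sqr_sqrtr (ltW (g_gt0 i u)); have gj := sqr_sqrtr (ltW (g_gt0 j u)).
set S := sec_curv _ _ _ _ _ _; set ri := Num.sqrt _ in gi *.
set rj := Num.sqrt _ in gj *; by rewrite -gi -gj; ring.
Qed.

End DiagonalFrame.

(** * Block-conformal warped metrics *)

Section BlockMetric.
Local Open Scope classical_set_scope.
Local Open Scope ring_scope.
Variables (R : realType) (d : nat) (o : 'I_d) (blk : 'I_d -> nat).
Variables (A kap : 'I_d -> R).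
Hypothesis blk_o : forall c, blk c = blk o -> c = o.
Hypothesis A_blk : forall b c, blk b = blk c -> A b = A c.
Hypothesis kap_blk : forall b c, blk b = blk c -> kap b = kap c.
Hypothesis A_o : A o = 0.
Hypothesis kap_o : kap o = 1.
Hypothesis kap_gt0 : forall b, 0 < kap b.

Definition same_blk (c b : 'I_d) : bool := (blk c == blk b) && (b != o).

Definition blk_sqnorm b (u : 'rV[R]_d) : R := \sum_c (same_blk c b)%:R * u 0 c ^+ 2.

(** With [r = u 0 o], the metric is [dr^2] plus, for every other block B, [kap_B e^(A_B r^2)] times
    the stereographic form [|du_B|^2 / (1 + |u_B|^2)^2] of a round metric of curvature 4. The sphere
    is one block and each circle of the torus is another, so one computation covers both. As
    [same_blk] excludes [o], the line gets weight 1. *)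
Definition blk_weight b (u : 'rV[R]_d) : R :=
  kap b * (expR (A b * u 0 o ^+ 2) * (1 + blk_sqnorm b u)^-1 ^+ 2).

(** Partial derivatives of [A b r^2 / 2 - log (1 + blk_sqnorm b u)], which is half the logarithm of
    the weight up to a constant. *)
Definition blk_logd a b (u : 'rV[R]_d) : R :=
  (a == o)%:R * A b * u 0 o
  + (- 2 * (same_blk a b)%:R) * (u 0 a * (1 + blk_sqnorm b u)^-1).

Definition blk_logdd c a b (u : 'rV[R]_d) : R :=
  (a == o)%:R * A b * (c == o)%:R
  + (- 2 * (same_blk a b)%:R) * ((a == c)%:R * (1 + blk_sqnorm b u)^-1
     - 2 * (same_blk c b)%:R * u 0 a * u 0 c * (1 + blk_sqnorm b u)^-1 ^+ 2).

Lemma blk_sqnorm_ge0 b u : 0 <= blk_sqnorm b u.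
Proof. by apply: sumr_ge0 => c _; rewrite mulr_ge0 ?ler0n ?sqr_ge0. Qed.

Let blk_sqnorm1_gt0 b u : 0 < 1 + blk_sqnorm b u.
Proof. by rewrite ltr_pwDl ?ltr01 ?blk_sqnorm_ge0. Qed.

Let blk_sqnorm1_neq0 b u : 1 + blk_sqnorm b u != 0.
Proof. by rewrite gt_eqF. Qed.

Lemma blk_weight_gt0 b u : 0 < blk_weight b u.
Proof. by rewrite !mulr_gt0 ?kap_gt0 ?expR_gt0 ?exprn_gt0 ?invr_gt0. Qed.

Let blk_weight_neq0 b u : blk_weight b u != 0.
Proof. by rewrite gt_eqF // blk_weight_gt0. Qed.

Lemma is_derive_coord a b (u : 'rV[R]_d) :
  is_derive u (delta_mx 0 a) (fun v : 'rV[R]_d => v 0 b) (a == b)%:R.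
Proof.
apply: is_derive_eq (is_derive_entry b (is_derive_id u (delta_mx 0 a))) _.
by rewrite mxE eqxx eq_sym.
Qed.

Lemma blk_sqnorm_derive a b u :
  is_derive u (delta_mx 0 a) (blk_sqnorm b) (2 * (same_blk a b)%:R * u 0 a).
Proof.
have H c := is_derive_scale (same_blk c b)%:R (is_derive_sqr (is_derive_coord a c u)).
apply: is_derive_eq (is_derive_fsum H) _.
rewrite -(sum_delta (fun c => 2 * (same_blk c b)%:R * u 0 c) a).
by apply: eq_bigr => c _; rewrite eq_sym; ring.
Qed.

Lemma blk_sqnorm1V_derive a b u :
  is_derive u (delta_mx 0 a) (fun v => (1 + blk_sqnorm b v)^-1)
   (- (2 * (same_blk a b)%:R * u 0 a) * (1 + blk_sqnorm b u)^-1 ^+ 2).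
Proof.
have H : is_derive u (delta_mx 0 a) (fun v => 1 + blk_sqnorm b v) _ :=
  is_derive_add (is_derive_cst (1 : R) u (delta_mx 0 a)) (blk_sqnorm_derive a b u).
apply: is_derive_eq (is_derive_inv (f := fun v => 1 + blk_sqnorm b v) _ H) _ => //.
by rewrite add0r exprVn.
Qed.

Lemma blk_weight_derive a b u :
  is_derive u (delta_mx 0 a) (blk_weight b) (2 * blk_logd a b u * blk_weight b u).
Proof.
have H1 := is_derive_expR_comp
  (is_derive_scale (A b) (is_derive_sqr (is_derive_coord a o u))).
have H2 := is_derive_sqr (blk_sqnorm1V_derive a b u).
apply: is_derive_eq (is_derive_scale (kap b) (is_derive_mul H1 H2)) _.
by rewrite /blk_logd /blk_weight; ring.
Qed.

Lemma blk_logd_derive c a b u :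
  is_derive u (delta_mx 0 c) (blk_logd a b) (blk_logdd c a b u).
Proof.
have H1 := is_derive_scale ((a == o)%:R * A b) (is_derive_coord c o u).
have H2 := is_derive_scale (- 2 * (same_blk a b)%:R)
  (is_derive_mul (is_derive_coord c a u) (blk_sqnorm1V_derive c b u)).
apply: is_derive_eq (is_derive_add H1 H2) _.
by rewrite /blk_logdd [c == a]eq_sym; congr (_ + _ * _); ring.
Qed.

Lemma blk_logdd_sym c a b u : blk_logdd c a b u = blk_logdd a c b u.
Proof.
rewrite /blk_logdd; congr (_ + _); first by ring.
by rewrite [c == a]eq_sym; case: (eqVneq a c) => [->|_]; rewrite /= ?mulr0n; ring.
Qed.

Lemma same_blk_o b : b != o -> same_blk o b = false.
Proof.
by move=> bo; apply/negP => /andP[/eqP/esym/blk_o/eqP]; rewrite (negPf bo).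
Qed.

Lemma same_blk_to_o a : same_blk a o = false.
Proof. by rewrite /same_blk eqxx andbF. Qed.

Lemma blk_sqnorm_o u : blk_sqnorm o u = 0.
Proof. by apply: big1 => c _; rewrite same_blk_to_o mul0r. Qed.

Lemma same_blk_sqnorm a b u : b != o -> blk a = blk b ->
  blk_sqnorm a u = blk_sqnorm b u.
Proof.
move=> bo ab; have ao : a != o.
  by apply: contra_neq bo => ao; apply: blk_o; rewrite -ab ao.
by apply: eq_bigr => c _; rewrite /same_blk ab ao bo.
Qed.

Lemma same_blk_weight a b u : b != o -> blk a = blk b ->
  blk_weight a u = blk_weight b u.
Proof.
move=> bo ab; rewrite /blk_weight (same_blk_sqnorm _ bo ab).
by rewrite (A_blk ab) (kap_blk ab).
Qed.

(** The weight of [i] depends only on [r] and on its own block. If all three indices share a block,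
    both sides equal the product of the two first derivatives. If one of [j], [l] is [o] and the
    other is in the block of [i], the two rates agree and the right-hand side cancels. Otherwise all
    terms vanish. *)
Lemma blk_logdd_offdiag i j l u : i != j -> i != l -> j != l ->
  blk_logdd j l i u = blk_logd l i u * blk_logd j l u
   + blk_logd j i u * blk_logd l j u - blk_logd j i u * blk_logd l i u.
Proof.
move=> ij il jl; rewrite /blk_logdd /blk_logd [l == j]eq_sym (negPf jl).
have [iE|io] := eqVneq i o.
  by rewrite iE !same_blk_to_o A_o /= ?mulr0n; ring.
have [lE|lo] := eqVneq l o.
  have jo : j != o by rewrite -lE.
  rewrite lE ?eqxx (negPf jo) same_blk_to_o (same_blk_o io) (same_blk_o jo).
  case B : (same_blk j i); last by rewrite /= ?mulr0n; ring.
  by have /andP[/eqP/A_blk -> _] := B; rewrite /= ?mulr0n; ring.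
have [jE|jo] := eqVneq j o.
  rewrite jE ?eqxx same_blk_to_o (same_blk_o io) (same_blk_o lo).
  case B : (same_blk l i); last by rewrite /= ?mulr0n; ring.
  by have /andP[/eqP/A_blk -> _] := B; rewrite /= ?mulr0n; ring.
case Bl : (same_blk l i); case Bj : (same_blk j i).
- have /andP[/eqP li _] := Bl; have /andP[/eqP ji _] := Bj.
  rewrite (same_blk_sqnorm u io li) (same_blk_sqnorm u io ji).
  rewrite /same_blk li ji eqxx lo jo; by rewrite /= ?mulr0n; ring.
- have -> : same_blk j l = false.
    by move: Bj; rewrite /same_blk; have /andP[/eqP -> _] := Bl; rewrite lo io.
  by rewrite /= ?mulr0n; ring.
- have -> : same_blk l j = false.
    by move: Bl; rewrite /same_blk; have /andP[/eqP -> _] := Bj; rewrite jo io.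
  by rewrite /= ?mulr0n; ring.
- by rewrite /= ?mulr0n; ring.
Qed.

Definition blk_sec i j u := sec_curv blk_weight blk_logd blk_logdd i j u.

Lemma blk_grad_dot i j u : i != o -> j != o ->
  grad_dot blk_weight blk_logd i j u = A i * A j * u 0 o ^+ 2 +
   (blk i == blk j)%:R *
   (4 * blk_sqnorm i u / (1 + blk_sqnorm i u) ^+ 2 / blk_weight i u).
Proof.
move=> io jo; rewrite /grad_dot (bigD1 o) //=; congr (_ + _).
  rewrite /blk_logd eqxx !same_blk_o // /blk_weight A_o kap_o mul0r expR0.
  by rewrite blk_sqnorm_o addr0 invr1 /= ?mulr0n; field; rewrite !blk_sqnorm1_neq0.
have H : blk_sqnorm i u = \sum_(c | c != o) (same_blk c i)%:R * u 0 c ^+ 2.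
  by rewrite {1}/blk_sqnorm (bigD1 o) //= same_blk_o // mul0r add0r.
rewrite {1}H mulr_sumr !mulr_suml mulr_sumr; apply: eq_bigr => b bo.
rewrite /blk_logd (negPf bo) {1 2}/same_blk io jo !andbT.
have [bi|bi] := eqVneq (blk b) (blk i); last first.
  by rewrite /same_blk (negPf bi) /= ?mulr0n; ring.
rewrite /same_blk bi eqxx io (same_blk_weight u io bi).
have [ij|ij] := eqVneq (blk i) (blk j); last by rewrite /= ?mulr0n; ring.
rewrite (same_blk_sqnorm u jo ij); rewrite /= ?mulr1n; field.
by rewrite blk_sqnorm1_neq0 blk_weight_neq0.
Qed.

(** This is [- phi'' / phi] for the warping function [phi = e^(A r^2 / 2)]. *)
Lemma blk_sec_o j u : j != o -> blk_sec o j u = - (A j + A j ^+ 2 * u 0 o ^+ 2).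
Proof.
move=> jo; rewrite /blk_sec /sec_curv.
have p0 b : blk_logd b o u = 0.
  by rewrite /blk_logd A_o same_blk_to_o /= ?mulr0n; ring.
rewrite [grad_dot _ _ _ _ _](_ : _ = 0); last first.
  by apply: big1 => b _; rewrite p0 !mul0r.
rewrite !p0 /blk_logdd /blk_logd same_blk_o // same_blk_to_o A_o !eqxx.
rewrite [blk_weight o u](_ : _ = 1).
  by rewrite /= ?mulr0n ?mulr1n; field; rewrite ?blk_sqnorm1_neq0 ?blk_weight_neq0.
by rewrite /blk_weight A_o kap_o mul0r expR0 blk_sqnorm_o addr0 invr1 expr1n !mulr1.
Qed.

(** The curvature 4 of the stereographic block, divided by its scale, minus [(phi' / phi)^2]. *)
Lemma blk_sec_same i j u : i != j -> i != o -> j != o -> blk i = blk j ->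
  blk_sec i j u = 4 / (kap i * expR (A i * u 0 o ^+ 2)) - A i ^+ 2 * u 0 o ^+ 2.
Proof.
move=> ij io jo bij; rewrite /blk_sec /sec_curv blk_grad_dot // bij eqxx.
rewrite -(same_blk_weight u jo bij) -(A_blk bij).
rewrite /blk_logdd /blk_logd (negPf io) (negPf jo) -(same_blk_sqnorm u jo bij).
rewrite /same_blk bij !eqxx io jo /blk_weight /= ?mulr1n ?mulr0n; field.
by rewrite blk_sqnorm1_neq0 (gt_eqF (kap_gt0 _)) (gt_eqF (expR_gt0 _)).
Qed.

(** Minus the product of the logarithmic derivatives of the two warping functions. *)
Lemma blk_sec_other i j u : i != o -> j != o -> blk i <> blk j ->
  blk_sec i j u = - (A i * A j * u 0 o ^+ 2).
Proof.
move=> io jo /eqP bij; rewrite /blk_sec /sec_curv blk_grad_dot // (negPf bij).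
rewrite /blk_logdd /blk_logd (negPf io) (negPf jo) /same_blk (negPf bij).
by rewrite [blk j == blk i]eq_sym (negPf bij) /= ?mulr0n; ring.
Qed.

Lemma blk_frame_curvature_ge (m : nat) u (K : R) (e : 'I_d -> 'rV[R]_d) :
  (m <= d)%N -> orthonormal_basis (diag_metric blk_weight u) e ->
  (forall i j, i != j -> blk_sec i j u <= K) ->
  \sum_i \sum_(j | j != i) blk_sec i j u - K * ((d - m)%:R ^+ 2 - (d - m)%:R) <=
  2 * frame_curvature m (diag_metric blk_weight) u e.
Proof.
exact: (frame_curvature_diag_ge blk_weight_gt0 blk_weight_derive blk_logd_derive
  blk_logdd_sym blk_logdd_offdiag).
Qed.

End BlockMetric.

(** * Curvature of the doubly warped metric *)

Section WarpedMetric.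
Local Open Scope classical_set_scope.
Local Open Scope ring_scope.
Variables (R : realType) (k j : nat).

Definition idxS (a : 'I_k) : 'I_(k + j + 1) := lshift 1 (lshift j a).
Definition idxT (t : 'I_j) : 'I_(k + j + 1) := lshift 1 (rshift k t).
Definition idxR : 'I_(k + j + 1) := rshift (k + j) ord0.

(** Every circle of the torus is a block of its own, since a block of several coordinates would
    carry a round metric instead of a flat one. *)
Definition factor_blk (b : 'I_(k + j + 1)) : nat :=
  match fintype.split b with
  | inl c => match fintype.split c with inl _ => 0%N | inr t => t.+1 end
  | inr _ => j.+1
  end.

Definition torus_rate : R := k%:R / j.+1%:R.

Definition warp_rate (b : 'I_(k + j + 1)) : R :=
  if factor_blk b == 0%N then -1 else if factor_blk b == j.+1 then 0 else torus_rate.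

(** The 4 turns the stereographic block into the unit sphere. *)
Definition warp_scale (b : 'I_(k + j + 1)) : R :=
  if factor_blk b == 0%N then 4 / (1 + torus_rate) else 1.

Lemma idxP (P : 'I_(k + j + 1) -> Prop) :
  (forall a, P (idxS a)) -> (forall t, P (idxT t)) -> P idxR -> forall b, P b.
Proof.
move=> HS HT HR b; case: (split_ordP b) => [c ->|c ->]; last by rewrite ord1.
by case: (split_ordP c) => e ->; [exact: HS|exact: HT].
Qed.

Lemma sum_idx (F : 'I_(k + j + 1) -> R) :
  \sum_b F b = \sum_a F (idxS a) + \sum_t F (idxT t) + F idxR.
Proof.
rewrite big_split_ord big_split_ord /=. by rewrite big_ord1.
Qed.

Lemma blkS a : factor_blk (idxS a) = 0%N.
Proof. by rewrite /factor_blk /idxS !(unsplitK (inl _)). Qed.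

Lemma blkT t : factor_blk (idxT t) = t.+1.
Proof. by rewrite /factor_blk /idxT (unsplitK (inl _)) (unsplitK (inr _)). Qed.

Lemma blkR : factor_blk idxR = j.+1.
Proof. by rewrite /factor_blk /idxR (unsplitK (inr _)). Qed.

Lemma rateS a : warp_rate (idxS a) = -1.
Proof. by rewrite /warp_rate blkS. Qed.

Lemma rateT t : warp_rate (idxT t) = torus_rate.
Proof. by rewrite /warp_rate blkT eqSS (ltn_eqF (ltn_ord t)). Qed.

Lemma rateR : warp_rate idxR = 0.
Proof. by rewrite /warp_rate blkR eqxx. Qed.

Lemma scaleR : warp_scale idxR = 1.
Proof. by rewrite /warp_scale blkR. Qed.

Lemma torus_rate_ge0 : 0 <= torus_rate.
Proof. by rewrite divr_ge0 ?ler0n. Qed.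

Lemma warp_scale_gt0 b : 0 < warp_scale b.
Proof.
rewrite /warp_scale; case: ifP => // _.
by rewrite divr_gt0 ?ltr0n // ltr_pwDl ?ltr01 ?torus_rate_ge0.
Qed.

Lemma blk_idxR c : factor_blk c = factor_blk idxR -> c = idxR.
Proof.
elim/idxP: c => [a|t|//]; rewrite blkR ?blkS ?blkT // => -[tj].
by have := ltn_ord t; rewrite tj ltnn.
Qed.

Lemma rate_blk b c : factor_blk b = factor_blk c -> warp_rate b = warp_rate c.
Proof. by rewrite /warp_rate => ->. Qed.

Lemma scale_blk b c : factor_blk b = factor_blk c -> warp_scale b = warp_scale c.
Proof. by rewrite /warp_scale => ->. Qed.

Lemma idxS_neqR a : idxS a != idxR.
Proof. by apply/eqP => /(congr1 factor_blk); rewrite blkS blkR. Qed.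

Lemma idxT_neqR t : idxT t != idxR.
Proof.
apply/eqP => /(congr1 factor_blk); rewrite blkT blkR => -[tj].
by have := ltn_ord t; rewrite tj ltnn.
Qed.

Lemma idxS_eq a b : (idxS a == idxS b) = (a == b).
Proof. by rewrite /idxS !eq_lshift. Qed.

Lemma idxT_eq a b : (idxT a == idxT b) = (a == b).
Proof. by rewrite /idxT eq_lshift eq_rshift. Qed.

Lemma idxST a t : (idxS a == idxT t) = false.
Proof. by rewrite /idxS /idxT eq_lshift eq_lrshift. Qed.

Definition warp_weight := blk_weight idxR factor_blk warp_rate warp_scale.

Definition warp_metric : 'rV[R]_(k + j + 1) -> 'M[R]_(k + j + 1) :=
  diag_metric warp_weight.

Let sec := blk_sec idxR factor_blk warp_rate warp_scale.

Let sec_sym a b u : sec a b u = sec b a u.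
Proof. exact: sec_curv_sym. Qed.

Let secRS a u : sec idxR (idxS a) u = 1 - u 0 idxR ^+ 2.
Proof.
rewrite /sec (blk_sec_o blk_idxR rateR scaleR warp_scale_gt0) ?idxS_neqR // rateS.
by ring.
Qed.

Let secRT t u : sec idxR (idxT t) u = - (torus_rate + torus_rate ^+ 2 * u 0 idxR ^+ 2).
Proof.
by rewrite /sec (blk_sec_o blk_idxR rateR scaleR warp_scale_gt0) ?idxT_neqR // rateT.
Qed.

Let secST a t u : sec (idxS a) (idxT t) u = torus_rate * u 0 idxR ^+ 2.
Proof.
rewrite /sec (blk_sec_other blk_idxR rate_blk scale_blk rateR scaleR warp_scale_gt0)
  ?idxS_neqR ?idxT_neqR // ?blkS ?blkT // rateS rateT; ring.
Qed.

Let secTT s t u : s != t ->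
  sec (idxT s) (idxT t) u = - (torus_rate ^+ 2 * u 0 idxR ^+ 2).
Proof.
move=> st.
rewrite /sec (blk_sec_other blk_idxR rate_blk scale_blk rateR scaleR warp_scale_gt0)
  ?idxT_neqR // ?blkT ?rateT //.
by move=> [] /val_inj /eqP; rewrite (negPf st).
Qed.

Let secSS a b u : a != b -> sec (idxS a) (idxS b) u =
  (1 + torus_rate) * expR (u 0 idxR ^+ 2) - u 0 idxR ^+ 2.
Proof.
move=> ab.
rewrite /sec (blk_sec_same blk_idxR rate_blk scale_blk rateR scaleR warp_scale_gt0)
  ?idxS_neqR ?idxS_eq // ?blkS // rateS /warp_scale blkS eqxx mulN1r expRN.
have := expR_gt0 (u 0 idxR ^+ 2); have := torus_rate_ge0.
move: (expR _) torus_rate => E s s0 E0; field.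
by rewrite !gt_eqF // ltr_pwDl ?ltr01.
Qed.

(** By [e^x >= 1 + x] the right-hand side is at least [1 + s + s r^2], which bounds [s r^2],
    [1 - r^2] and the nonpositive curvatures of the remaining planes. *)
Let sec_le a b u : a != b -> sec a b u <=
  (1 + torus_rate) * expR (u 0 idxR ^+ 2) - u 0 idxR ^+ 2.
Proof.
have s0 := torus_rate_ge0; have r0 := sqr_ge0 (u 0 idxR).
have E1 := expR_ge1Dx (u 0 idxR ^+ 2).
have key : 1 + torus_rate + torus_rate * u 0 idxR ^+ 2 <=
   (1 + torus_rate) * expR (u 0 idxR ^+ 2) - u 0 idxR ^+ 2.
  set E := expR _ in E1 *; set r := u 0 idxR ^+ 2 in r0 E1 *.
  set s := torus_rate in s0 *; clearbody E r s; nra.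
have s2 := sqr_ge0 torus_rate.
have sr : 0 <= torus_rate * u 0 idxR ^+ 2 by exact: mulr_ge0.
have s2r : 0 <= torus_rate ^+ 2 * u 0 idxR ^+ 2 by exact: mulr_ge0.
move: key; set K := _ - _ => key.
elim/idxP: a => [a|a|]; elim/idxP: b => [b|b|];
  rewrite ?idxS_eq ?idxT_eq ?eqxx // => ab.
- by rewrite secSS.
- by rewrite secST; lra.
- by rewrite sec_sym secRS; lra.
- by rewrite sec_sym secST; lra.
- by rewrite secTT //; lra.
- by rewrite sec_sym secRT; lra.
- by rewrite secRS; lra.
- by rewrite secRT; lra.
Qed.

Let sum_others n (a : 'I_n) (F : 'I_n -> R) (c : R) :
  (forall b, a != b -> F b = c) -> \sum_(b | b != a) F b = n%:R * c - c.
Proof.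
move=> Fc; rewrite (eq_bigr (fun=> c)); last by move=> b ba; rewrite Fc // eq_sym.
have : \sum_(b < n) c = n%:R * c by rewrite sumr_const card_ord mulr_natl.
by rewrite (bigD1 a) //= => <-; rewrite addrAC subrr add0r.
Qed.

Let sum_sec u : \sum_a \sum_(b | b != a) sec a b u =
  k%:R * (k%:R - 1) * ((1 + torus_rate) * expR (u 0 idxR ^+ 2) - u 0 idxR ^+ 2)
  + 2 * k%:R * j%:R * (torus_rate * u 0 idxR ^+ 2)
  + 2 * k%:R * (1 - u 0 idxR ^+ 2)
  - j%:R * (j%:R - 1) * (torus_rate ^+ 2 * u 0 idxR ^+ 2)
  - 2 * j%:R * (torus_rate + torus_rate ^+ 2 * u 0 idxR ^+ 2).
Proof.
set K := (1 + _) * _ - _.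
have cst n (F : 'I_n -> R) c : (forall i, F i = c) -> \sum_i F i = n%:R * c.
  by move=> Fc; under eq_bigr do rewrite Fc; rewrite sumr_const card_ord mulr_natl.
under eq_bigr do rewrite big_mkcond.
rewrite sum_idx.
rewrite (cst _ _ ((k%:R * K - K) + j%:R * (torus_rate * u 0 idxR ^+ 2)
    + (1 - u 0 idxR ^+ 2))); last first.
  move=> a; rewrite sum_idx; congr (_ + _ + _).
  - rewrite -big_mkcond /=; under eq_bigl do rewrite idxS_eq.
    by apply: (@sum_others _ a) => b ab; rewrite secSS.
  - by apply: cst => t; rewrite eq_sym idxST secST.
  - by rewrite eq_sym idxS_neqR sec_sym secRS.
rewrite (cst _ _ (k%:R * (torus_rate * u 0 idxR ^+ 2) +
    (j%:R * - (torus_rate ^+ 2 * u 0 idxR ^+ 2) - - (torus_rate ^+ 2 * u 0 idxR ^+ 2))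
    - (torus_rate + torus_rate ^+ 2 * u 0 idxR ^+ 2))); last first.
  move=> t; rewrite sum_idx; congr (_ + _ + _).
  - by apply: cst => a; rewrite idxST sec_sym secST.
  - rewrite -big_mkcond /=; under eq_bigl do rewrite idxT_eq.
    by apply: (@sum_others _ t) => b ab; rewrite secTT.
  - by rewrite eq_sym idxT_neqR sec_sym secRT.
rewrite sum_idx eqxx (cst _ _ (1 - u 0 idxR ^+ 2)); last first.
  by move=> a; rewrite idxS_neqR secRS.
rewrite (cst _ _ (- (torus_rate + torus_rate ^+ 2 * u 0 idxR ^+ 2))); last first.
  by move=> t; rewrite idxT_neqR secRT.
by rewrite /=; ring.
Qed.

(** The planes tangent to the sphere contribute [k (k - 1)] times the maximal curvature, exactly
    what the general bound subtracts, so the exponential cancels. With [k = s (j + 1)] the rest is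
    [2 s + k (j s - 2) r^2]. *)
Lemma warp_frame_curvature_ge u (e : 'I_(k + j + 1) -> 'rV[R]_(k + j + 1)) :
  (2 * j.+1 <= j * k)%N -> orthonormal_basis (warp_metric u) e ->
  torus_rate <= frame_curvature j.+1 warp_metric u e.
Proof.
move=> jk He.
have md : (j.+1 <= k + j + 1)%N by rewrite addn1 ltnS leq_addl.
have := blk_frame_curvature_ge blk_idxR rate_blk rateR warp_scale_gt0 md He
  (fun a b => @sec_le a b u).
rewrite -/sec sum_sec.
have -> : (k + j + 1 - j.+1 = k)%N by rewrite addn1 subSS addnK.
set K := (1 + _) * _ - _; rewrite -/warp_metric.
set F := frame_curvature _ _ _ _; move: F => F H.
have r0 := sqr_ge0 (u 0 idxR); have s0 := torus_rate_ge0.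
have ks : k%:R = torus_rate * (j%:R + 1).
  by rewrite /torus_rate natr1 divfK // pnatr_eq0.
have jk' : 2 * (j%:R + 1) <= j%:R * k%:R :> R by rewrite natr1 -!natrM ler_nat.
have js : 2 <= j%:R * torus_rate.
  have j1 : 0 < j%:R + 1 :> R by rewrite natr1 ltr0n.
  by rewrite -(ler_pM2r j1) -mulrA -ks.
have k0 : 0 <= k%:R :> R by [].
have kjs : 0 <= k%:R * (j%:R * torus_rate - 2) * u 0 idxR ^+ 2.
  by apply: mulr_ge0 => //; apply: mulr_ge0; [exact: ler0n|rewrite subr_ge0].
rewrite /K in H; clear k0 jk' js K.
set E := expR _ in H; set r := u 0 idxR ^+ 2 in r0 H kjs *.
set s := torus_rate in ks s0 H kjs *; set j' := j%:R in ks H kjs.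
rewrite ks in H kjs; clearbody E r s j'.
nra.
Qed.

End WarpedMetric.

(** * Invariance under changes of charts *)

Section Isometry.
Local Open Scope classical_set_scope.
Local Open Scope ring_scope.
Variable R : realType.

Lemma derive_comp_linear d d' (L : {linear 'rV[R]_d' -> 'rV[R]_d})
    (f : 'rV[R]_d -> R) u v :
  'D_v (f \o L) u = 'D_(L v) f (L u).
Proof.
rewrite /derive; set g1 := fun h => h^-1 *: _; set g2 := fun h => h^-1 *: _.
by suff -> : g1 = g2 by []; apply/funext => h; rewrite /g1 /g2 /= linearP.
Qed.

Lemma lsubmx_delta_lshift m n (a : 'I_m) :
  lsubmx (delta_mx 0 (lshift n a) : 'rV[R]_(m + n)) = delta_mx 0 a.
Proof. by apply/rowP => i; rewrite !mxE eq_lshift. Qed.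

Lemma lsubmx_delta_rshift m n (a : 'I_n) :
  lsubmx (delta_mx 0 (rshift m a) : 'rV[R]_(m + n)) = 0.
Proof. by apply/rowP => i; rewrite !mxE eq_lrshift andbF. Qed.

Lemma rsubmx_delta_lshift m n (a : 'I_m) :
  rsubmx (delta_mx 0 (lshift n a) : 'rV[R]_(m + n)) = 0.
Proof. by apply/rowP => i; rewrite !mxE eq_rlshift andbF. Qed.

Lemma rsubmx_delta_rshift m n (a : 'I_n) :
  rsubmx (delta_mx 0 (rshift m a) : 'rV[R]_(m + n)) = delta_mx 0 a.
Proof. by apply/rowP => i; rewrite !mxE eq_rshift. Qed.

Lemma transition_jac_prod d1 d2 (M1 : manifold R d1) (M2 : manifold R d2)
    (i j : chart (prod_manifold M1 M2)) w :
  transition_jac i j w = block_mx (transition_jac i.1 j.1 (lsubmx w)) 0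
                                  0 (transition_jac i.2 j.2 (rsubmx w)).
Proof.
have El b : (fun v => coord j (param i v) 0 (lshift d2 b)) =
    (fun u => coord j.1 (param i.1 u) 0 b) \o lsubmx.
  by apply/funext => v; rewrite /= /prod_coord row_mxEl.
have Er b : (fun v => coord j (param i v) 0 (rshift d1 b)) =
    (fun u => coord j.2 (param i.2 u) 0 b) \o rsubmx.
  by apply/funext => v; rewrite /= /prod_coord row_mxEr.
apply/matrixP => a b; rewrite mxE /pd.
case: (split_ordP a) => a' ->; case: (split_ordP b) => b' ->;
  rewrite ?El ?Er derive_comp_linear /=.
- by rewrite lsubmx_delta_lshift block_mxEul mxE.
- by rewrite rsubmx_delta_lshift derive0 block_mxEur mxE.
- by rewrite lsubmx_delta_rshift derive0 block_mxEdl mxE.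
- by rewrite rsubmx_delta_rshift block_mxEdr mxE.
Qed.

(** The condition [gram_compat] for the metric that has the same diagonal Gram matrix [h] in every
    chart. *)
Definition invariant_weight d (M : manifold R d) (h : 'rV[R]_d -> 'rV[R]_d) : Prop :=
  forall (i j : chart M) x, dom i x -> dom j x ->
  diag_mx (h (coord i x)) = transition_jac i j (coord i x)
    *m diag_mx (h (coord j x)) *m (transition_jac i j (coord i x))^T.

(** The factors [c1] and [c2] are functions of the point, hence the same in both charts: scaling
    each diagonal block by them preserves invariance. *)
Lemma invariant_weight_prod d1 d2 (M1 : manifold R d1) (M2 : manifold R d2) h1 h2
    (c1 c2 : M1 * M2 -> R) (h : 'rV[R]_(d1 + d2) -> 'rV[R]_(d1 + d2)) :
  invariant_weight M1 h1 -> invariant_weight M2 h2 ->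
  (forall (i : chart (prod_manifold M1 M2)) x, dom i x ->
     h (coord i x) =
     row_mx (c1 x *: h1 (coord i.1 x.1)) (c2 x *: h2 (coord i.2 x.2))) ->
  invariant_weight (prod_manifold M1 M2) h.
Proof.
move=> I1 I2 hE i j x ix jx; have [ix1 ix2] := ix; have [jx1 jx2] := jx.
rewrite !hE // transition_jac_prod /= /prod_coord row_mxKl row_mxKr.
rewrite !diag_mx_row tr_block_mx !trmx0 !mulmx_block.
rewrite !(mulmx0, mul0mx, addr0, add0r) !linearZ /=.
rewrite (I1 _ _ _ ix1 jx1) (I2 _ _ _ ix2 jx2).
by rewrite -!scalemxAl.
Qed.

Lemma transition_jac_id d (M : manifold R d) (i j : chart M) :
  (forall u, coord j (param i u) = u) -> forall u, transition_jac i j u = 1%:M.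
Proof.
move=> K u; apply/matrixP => a b; rewrite !mxE /pd.
under [X in 'D__ X _]eq_fun do rewrite K.
exact: (@derive_val _ _ _ _ _ _ _ (is_derive_coord a b u)).
Qed.

Lemma invariant_weight_line : invariant_weight (line R) (fun=> const_mx 1).
Proof.
move=> i j x _ _; have K : forall u, coord j (param i u) = u := @line_paramK R.
rewrite (transition_jac_id K).
by rewrite trmx1 mul1mx mulmx1.
Qed.

Lemma invariant_weight_one_point h : invariant_weight (one_point R) h.
Proof. by move=> i j x _ _; apply/matrixP => -[]. Qed.

Definition stereo_weight k (u : 'rV[R]_k) : 'rV[R]_k :=
  const_mx ((1 + sqnorm u)^-1 ^+ 2).

(** Stated for all [u], and not only on the overlap of the charts, so that it can be rewritten under
    a derivative. *)
Lemma sphere_inversion k b c (u : 'rV[R]_k) : b != c ->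
  sphere_coord c (sphere_param b u) = (sqnorm u)^-1 *: u.
Proof.
move=> bc; rewrite sphere_coord_param; congr (_ *: _).
have s1 : sqnorm u + 1 != 0 by rewrite gt_eqF // sqnorm1_gt0.
have -> : 1 - (-1) ^+ c * ((-1) ^+ b * (sqnorm u - 1) / (sqnorm u + 1)) =
    (2 * sqnorm u) / (sqnorm u + 1) :> R.
  by case: b c bc => [] [] //= _; rewrite ?expr1 ?expr0; field.
(* At the origin, outside the overlap, both factors are 0 by the convention for the inverse of 0. *)
have [->|s0] := eqVneq (sqnorm u) 0; first by rewrite mulr0 mul0r !invr0 mul0r.
by field; rewrite s0 s1.
Qed.

Lemma is_derive_sqnorm k a (u : 'rV[R]_k) :
  is_derive u (delta_mx 0 a) (@sqnorm R k) (2 * u 0 a).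
Proof.
have H c := is_derive_sqr (is_derive_coord a c u).
apply: is_derive_eq (is_derive_fsum H) _.
rewrite -(sum_delta (fun c => 2 * u 0 c) a).
by apply: eq_bigr => c _; rewrite eq_sym; ring.
Qed.

(** The Jacobian of the inversion is [|u|^-2] times the reflection in the hyperplane orthogonal to
    [u], so it multiplies the Euclidean metric by [|u|^-4]; this matches
    [1 + |u|^-2 = (1 + |u|^2) / |u|^2]. *)
Lemma invariant_weight_sphere k :
  invariant_weight (sphere_manifold R k) (@stereo_weight k).
Proof.
move=> i j x ix jx.
have [->|ij] := eqVneq i j.
  have K : forall u, @coord _ _ (sphere_manifold R k) j (param j u) = u.
    exact: sphere_paramK.
  rewrite (transition_jac_id K).
  by rewrite trmx1 mul1mx mulmx1.
set u := coord i x.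
have s0 : sqnorm u != 0.
  have : (coord i @` (dom i `&` dom j)) u by exists x.
  by rewrite [X in X u](@sphere_overlapE R k i j) (negPf ij).
have -> : coord j x = (sqnorm u)^-1 *: u.
  by rewrite -{1}(coordK ix); exact: sphere_inversion.
have JE a b : transition_jac i j u a b =
    (a == b)%:R * (sqnorm u)^-1 - 2 * u 0 a * u 0 b * (sqnorm u)^-1 ^+ 2.
  rewrite mxE /pd.
  under [X in 'D__ X _]eq_fun do rewrite [coord _ _](sphere_inversion _ ij) mxE.
  have H := is_derive_mul (is_derive_inv s0 (is_derive_sqnorm a u))
    (is_derive_coord a b u).
  by rewrite (@derive_val _ _ _ _ _ _ _ H); field.
clearbody u; apply/matrixP => a b; rewrite /stereo_weight sqnormZ.
rewrite [LHS]mxE mxE [RHS]mxE.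
under eq_bigr do rewrite mul_mx_diag [(_^T) _ _]mxE mxE [const_mx _ _ _]mxE !JE.
set w : R := (1 + (sqnorm u)^-1 ^+ 2 * sqnorm u)^-1 ^+ 2.
have -> : (1 + sqnorm u)^-1 ^+ 2 = w * (sqnorm u)^-1 ^+ 2.
  have s1 : 1 + sqnorm u != 0 by rewrite addrC gt_eqF // sqnorm1_gt0.
  rewrite /w (_ : 1 + (sqnorm u)^-1 ^+ 2 * sqnorm u = (1 + sqnorm u) / sqnorm u);
    last by field.
  by field; rewrite s0 s1.
transitivity (\sum_c ((c == a)%:R * ((a == b)%:R * (w * (sqnorm u)^-1 ^+ 2)
     - 2 * u 0 a * u 0 b * (w * (sqnorm u)^-1 ^+ 3))
   - (c == b)%:R * (2 * u 0 a * u 0 b * (w * (sqnorm u)^-1 ^+ 3))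
   + 4 * u 0 a * u 0 b * w * (sqnorm u)^-1 ^+ 4 * u 0 c ^+ 2)).
  rewrite big_split sumrB /= !sum_delta -mulr_sumr -/(sqnorm u).
  by case: eqVneq => _; rewrite /= ?mulr0n ?mulr1n; field.
apply: eq_bigr => c _; rewrite [a == c]eq_sym [b == c]eq_sym.
have [->|ca] := eqVneq c a; first last.
  by case: (eqVneq c b) => [->|_]; rewrite /= ?mulr0n ?mulr1n; ring.
by case: (eqVneq a b) => [->|_]; rewrite /= ?mulr0n ?mulr1n; ring.
Qed.

Definition torus_weight j (t : 'rV[R]_j) : 'rV[R]_j :=
  \row_i (1 + t 0 i ^+ 2)^-1 ^+ 2.

Lemma torus_weightS j (t : 'rV[R]_(1 + j)) :
  torus_weight t = row_mx (stereo_weight (lsubmx t)) (torus_weight (rsubmx t)).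
Proof.
apply/rowP => i; case: (split_ordP i) => c ->.
  by rewrite row_mxEl !mxE /sqnorm big_ord1 ord1 mxE.
by rewrite row_mxEr !mxE.
Qed.

Lemma invariant_weight_torus j : invariant_weight (torus R j) (@torus_weight j).
Proof.
elim: j => [|j IH]; first exact: invariant_weight_one_point.
apply: (invariant_weight_prod (c1 := fun=> 1) (c2 := fun=> 1)
  (invariant_weight_sphere (k := 1)) IH) => i x _.
by rewrite torus_weightS /= /prod_coord row_mxKl row_mxKr !scale1r.
Qed.

End Isometry.

(** * The warped weights in the charts of the product *)

Section WarpedManifold.
Local Open Scope classical_set_scope.
Local Open Scope ring_scope.
Variables (R : realType) (k j : nat).

Let M := prod_manifold (prod_manifold (sphere_manifold R k) (torus R j)) (line R).

Lemma blk_sqnormS a (w : 'rV[R]_(k + j + 1)) :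
  blk_sqnorm (idxR k j) (@factor_blk k j) (idxS j a) w = sqnorm (lsubmx (lsubmx w)).
Proof.
rewrite /blk_sqnorm sum_idx /same_blk idxS_neqR !blkS blkR.
rewrite [X in _ + X + _]big1 ?mul0r ?addr0.
  by apply: eq_bigr => b _; rewrite blkS eqxx mul1r !mxE.
by move=> t _; rewrite blkT mul0r.
Qed.

Lemma blk_sqnormT t (w : 'rV[R]_(k + j + 1)) :
  blk_sqnorm (idxR k j) (@factor_blk k j) (idxT k t) w = rsubmx (lsubmx w) 0 t ^+ 2.
Proof.
rewrite /blk_sqnorm sum_idx /same_blk idxT_neqR !blkT blkR.
rewrite [X in X + _ + _]big1; last first.
  by move=> a _; rewrite blkS mul0r.
rewrite [j.+1 == _]eqSS gtn_eqF // mul0r addr0 add0r.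
rewrite (bigD1 t) //= blkT eqxx mul1r big1 ?addr0 ?mxE // => i it.
by rewrite blkT eqSS (inj_eq val_inj) (negPf it) mul0r.
Qed.

Lemma warp_weightE (w : 'rV[R]_(k + j + 1)) : \row_b @warp_weight R k j b w =
  row_mx (row_mx ((4 / (1 + torus_rate R k j) * expR (- rsubmx w 0 0 ^+ 2))
                     *: stereo_weight (lsubmx (lsubmx w)))
                 (expR (torus_rate R k j * rsubmx w 0 0 ^+ 2)
                     *: torus_weight (rsubmx (lsubmx w))))
         (const_mx 1).
Proof.
apply/rowP; elim/idxP => [a|t|].
- rewrite row_mxEl row_mxEl !mxE /warp_weight /blk_weight rateS /warp_scale blkS eqxx.
  rewrite mulN1r mulrA; congr (_ * (1 + _)^-1 ^+ 2).
  by rewrite blk_sqnormS.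
- rewrite row_mxEl row_mxEr !mxE /warp_weight /blk_weight rateT /warp_scale blkT mul1r.
  by rewrite blk_sqnormT !mxE.
rewrite row_mxEr !mxE /warp_weight /blk_weight rateR scaleR mul0r expR0 blk_sqnorm_o.
by rewrite addr0 invr1 expr1n !mulr1.
Qed.

Lemma warp_invariant : invariant_weight M (fun w => \row_b @warp_weight R k j b w).
Proof.
pose s := torus_rate R k j.
(* The line has a global coordinate, so [r] has the same value in both charts and the warping
   factors can be frozen as constants. *)
have I1 (r : R) : invariant_weight (prod_manifold (sphere_manifold R k) (torus R j))
    (fun w => row_mx ((4 / (1 + s) * expR (- r ^+ 2)) *: stereo_weight (lsubmx w))
                     (expR (s * r ^+ 2) *: torus_weight (rsubmx w))).
  apply: (invariant_weight_prod
    (c1 := fun=> 4 / (1 + s) * expR (- r ^+ 2)) (c2 := fun=> expR (s * r ^+ 2))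
    (invariant_weight_sphere (k := k)) (invariant_weight_torus (j := j))) => i x _.
  by rewrite /= /prod_coord row_mxKl row_mxKr.
move=> i i' x ix ix'.
have H y (c : chart M) : coord c y = row_mx (coord c.1 y.1) (coord c.2 y.2) by [].
rewrite !warp_weightE !H !row_mxKl !row_mxKr.
have [ix1 ix2] := ix; have [ix1' ix2'] := ix'.
have := I1 x.2 _ _ _ ix1 ix1'.
have Hl (c : chart (prod_manifold (sphere_manifold R k) (torus R j))) y :
  lsubmx (coord c y) = coord c.1 y.1 by exact: row_mxKl.
have Hr (c : chart (prod_manifold (sphere_manifold R k) (torus R j))) y :
  rsubmx (coord c y) = coord c.2 y.2 by exact: row_mxKr.
rewrite /s !Hl !Hr => E.
rewrite diag_mx_row transition_jac_prod !row_mxKl !row_mxKr.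
have r0 (c : chart (line R)) : coord c x.2 0 0 = x.2 by rewrite mxE.
rewrite !r0. rewrite E (invariant_weight_line ix2 ix2').
rewrite !diag_mx_row tr_block_mx !trmx0 !mulmx_block.
by rewrite !(mulmx0, mul0mx, addr0, add0r).
Qed.
End WarpedManifold.

(** * Smoothness of the weights *)

Section Smoothness.
Local Open Scope classical_set_scope.
Local Open Scope ring_scope.
Variables (R : realType) (d : nat).

Lemma Ck_expR n (U : set 'rV[R]_d) (f : 'rV[R]_d -> R) : open U -> Ck n U f ->
  Ck n U (fun u => expR (f u)).
Proof.
move=> oU; elim: n => [|n IH] Cf; have [cf Df] := Cf.
  split=> // u Uu; apply: (@continuous_comp _ _ _ f expR); first exact: cf.
  exact: continuous_expR.
split=> [u Uu|a].
  apply: (@continuous_comp _ _ _ f expR); first exact: cf.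
  exact: continuous_expR.
have [D1 D2] := Df a.
have H u : U u ->
    is_derive u (delta_mx 0 a) (fun v => expR (f v)) (expR (f u) * pd a f u).
  by move=> Uu; apply: is_derive_expR_comp; apply: derivableP; exact: D1.
split=> [u Uu|]; first exact: (@ex_derive _ _ _ _ _ _ _ (H u Uu)).
apply: Ck_ext (Ck_mul oU (IH (CkW Cf)) D2) => // u Uu.
by rewrite /pd (@derive_val _ _ _ _ _ _ _ (H u Uu)).
Qed.

Variables (o : 'I_d) (blk : 'I_d -> nat) (A kap : 'I_d -> R).

Lemma blk_weight_smooth b : smooth_on setT (blk_weight o blk A kap b).
Proof.
move=> n; have oT := @openT 'rV[R]_d.
have C1 : Ck n setT (fun u : 'rV[R]_d => expR (A b * (u 0 o * u 0 o))).
  apply: Ck_expR => //; apply: Ck_mul => //; first exact: Ck_cst.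
  by apply: Ck_mul => //; exact: Ck_coord.
have C2 : Ck n setT (fun u : 'rV[R]_d => 1 + blk_sqnorm o blk b u).
  apply: (Ck_add (f := fun=> 1)) => //; first exact: Ck_cst.
  apply: Ck_sum => // c; apply: Ck_mul => //; first exact: Ck_cst.
  have := Ck_mul oT (Ck_coord n setT c) (Ck_coord n setT c).
  by apply: Ck_ext => // u _; rewrite expr2.
have C3 : Ck n setT (fun u : 'rV[R]_d => (1 + blk_sqnorm o blk b u)^-1).
  by apply: Ck_inv => // u _; rewrite gt_eqF // ltr_pwDl ?ltr01 ?blk_sqnorm_ge0.
have := Ck_mul oT (Ck_cst n setT (kap b)) (Ck_mul oT C1 (Ck_mul oT C3 C3)).
by apply: Ck_ext => // u _; rewrite /blk_weight !expr2.
Qed.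

Lemma blk_weight_continuous b : continuous (blk_weight o blk A kap b).
Proof. by move=> u; exact: (Ck_cont (blk_weight_smooth b 0)). Qed.

End Smoothness.

(** * Integral estimates in one variable *)

Section OneVariable.
Local Open Scope classical_set_scope.
Local Open Scope ring_scope.
Variable R : realType.
Local Notation mu := (@lebesgue_measure R).

Lemma continuous_integrable_segment (f : R -> R) a b : continuous f ->
  mu.-integrable `[a, b] (EFin \o f).
Proof.
move=> cf; apply: continuous_compact_integrable; first exact: segment_compact.
by apply: continuous_subspaceT => x; exact: cf.
Qed.

(** The derivative of [f] is not assumed continuous, so it is not integrated: the primitive of [sp]
    minus [f] has a nonnegative derivative and is therefore monotone. *)
Lemma derive_le_integral (f sp : R -> R) : continuous sp ->
  (forall t, derivable f t 1) -> (forall t, 'D_1 f t <= sp t) ->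
  f 1 - f 0 <= \int[mu]_(t in `[0, 1]) sp t.
Proof.
move=> csp Df fsp.
pose L x := parameterized_integral mu 0 x sp.
have DL (x : R) : 0 < x -> is_derive x (1 : R) L (sp x).
  (* The bound [x + 1] makes [x], possibly equal to 1, interior to the interval of integration. *)
  move=> x0; have x1 : x < x + 1 by rewrite ltrDl.
  have [D1 D2] := continuous_FTC1_closed x1
    (continuous_integrable_segment 0 (x + 1) csp) x0 (csp x).
  by apply: DeriveDef; [exact: D1|rewrite -derive1E; exact: D2].
have DLf (x : R) : 0 < x -> is_derive x (1 : R) (fun y => L y - f y) (sp x - 'D_1 f x).
  move=> x0; apply: is_derive_add; first exact: DL.
  by apply: is_derive_opp; exact: derivableP.
have H : (L 0 - f 0 <= L 1 - f 1).
  apply: (@ger0_derive1_le_cc R (fun y => L y - f y) 0 1).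
  - move=> x; rewrite in_itv /= => /andP[x0 _].
    exact: (@ex_derive _ _ _ _ _ _ _ (DLf x x0)).
  - move=> x; rewrite in_itv /= => /andP[x0 _].
    by rewrite derive1E (@derive_val _ _ _ _ _ _ _ (DLf x x0)) subr_ge0.
  - move=> x; apply: continuousB.
      exact: (parameterized_integral_continuous ler01
        (continuous_integrable_segment 0 1 csp)).
    by apply: derivable_within_continuous => y _; exact: Df.
  - by rewrite in_itv /= lexx ler01.
  - by rewrite in_itv /= lexx ler01.
  - exact: ler01.
have L0 : L 0 = 0.
  by rewrite /L /parameterized_integral set_itv1 Rintegral_set1.
by rewrite -[leRHS]/(L 1); move: H; rewrite L0; lra.
Qed.

Lemma abs_derive_le_integral (f sp : R -> R) : continuous sp ->
  (forall t, derivable f t 1) -> (forall t, `|'D_1 f t| <= sp t) ->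
  `|f 1 - f 0| <= \int[mu]_(t in `[0, 1]) sp t.
Proof.
move=> csp Df fsp; rewrite ler_norml; apply/andP; split.
  have : (- f) 1 - (- f) 0 <= \int[mu]_(t in `[0, 1]) sp t.
    apply: derive_le_integral => // t; first exact: derivableN.
    by rewrite deriveN // (le_trans _ (fsp t)) // -normrN ler_norm.
  by rewrite !fctE; lra.
apply: derive_le_integral => // t.
by rewrite (le_trans _ (fsp t)) // ler_norm.
Qed.

Lemma integral01_le (f : R -> R) c : continuous f ->
  (forall t, 0 <= t <= 1 -> f t <= c) -> \int[mu]_(t in `[0, 1]) f t <= c.
Proof.
move=> cf fc.
have -> : c = \int[mu]_(_ in `[0, 1]) c.
  have := lebesgue_measure_itv (`[0, 1] : interval R).
  by rewrite Rintegral_cst //= => ->; rewrite lte_fin ltr01 sube0 /= mulr1.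
apply: le_Rintegral => //; first exact: continuous_integrable_segment.
by apply: continuous_integrable_segment => x; exact: cvg_cst.
Qed.

Lemma cauchy_sequence_cvg (u : nat -> R) :
  (forall e, 0 < e -> exists N, forall k l, (N <= k)%N -> (N <= l)%N ->
     `|u k - u l| < e) -> exists l : R, u n @[n --> \oo] --> l.
Proof.
move=> H; apply/cvg_ex; apply: R_complete; apply/cauchyP => e e0.
have [N HN] := H e e0; exists (u N); exists N => // n /= Nn.
exact: HN.
Qed.

End OneVariable.

(** * Completeness *)

Section Embedded.
Local Open Scope classical_set_scope.
Local Open Scope ring_scope.
Variable R : realType.

Lemma is_derive_row (V : normedModType R) n (c : V -> 'rV[R]_n) x v (w : 'rV[R]_n) :
  (forall b, is_derive x v (fun y => c y 0 b) (w 0 b)) -> is_derive x v c w.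
Proof.
move=> H.
have Dc : derivable c x v.
  by apply/derivable_mxP => i b; rewrite ord1; exact: (@ex_derive _ _ _ _ _ _ _ (H b)).
apply: DeriveDef => //; rewrite (derive_mx Dc); apply/rowP => b.
by rewrite mxE; exact: (@derive_val _ _ _ _ _ _ _ (H b)).
Qed.

Lemma is_derive_lsubmx (V : normedModType R) m n (c : V -> 'rV[R]_(m + n)) x v w :
  is_derive x v c w -> is_derive x v (fun y => lsubmx (c y)) (lsubmx w).
Proof.
move=> Hc; apply: is_derive_row => b; rewrite mxE.
by apply: is_derive_ext (is_derive_entry (lshift n b) Hc) => y; rewrite mxE.
Qed.

Lemma is_derive_rsubmx (V : normedModType R) m n (c : V -> 'rV[R]_(m + n)) x v w :
  is_derive x v c w -> is_derive x v (fun y => rsubmx (c y)) (rsubmx w).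
Proof.
move=> Hc; apply: is_derive_row => b; rewrite mxE.
by apply: is_derive_ext (is_derive_entry (rshift m b) Hc) => y; rewrite mxE.
Qed.

(** Again from Lagrange's identity. *)
Lemma cauchy_schwarz n (x y : 'I_n -> R) :
  (\sum_i x i * y i) ^+ 2 <= (\sum_i x i ^+ 2) * (\sum_i y i ^+ 2).
Proof.
have E : 2 * ((\sum_i x i ^+ 2) * (\sum_i y i ^+ 2) - (\sum_i x i * y i) ^+ 2) =
    \sum_i \sum_j (x i * y j - x j * y i) ^+ 2.
  transitivity ((\sum_i x i ^+ 2) * (\sum_i y i ^+ 2)
     + (\sum_i y i ^+ 2) * (\sum_i x i ^+ 2)
     - 2 * ((\sum_i x i * y i) * (\sum_i x i * y i))); first by ring.
  rewrite !mulr_suml mulr_sumr -big_split -sumrB /=; apply: eq_bigr => i _.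
  rewrite !mulr_sumr -big_split -sumrB /=; apply: eq_bigr => j _; ring.
rewrite -subr_ge0 -(pmulr_rge0 _ (ltr0Sn R 1)) E.
by do 2![apply: sumr_ge0 => ? _]; exact: sqr_ge0.
Qed.

Definition weighted_sqnorm d (h v : 'rV[R]_d) : R := \sum_b h 0 b * v 0 b ^+ 2.

(** The infinitesimal condition [|dF|^2 <= C], tested along curves in coordinates; the resulting
    Lipschitz constant is the square root of [C]. *)
Definition lipschitz_fun d (M : manifold R d) (h : 'rV[R]_d -> 'rV[R]_d) (C : R)
    (F : M -> R) : Prop :=
  forall (i : chart M) (c : R -> 'rV[R]_d) (t : R) (v : 'rV[R]_d),
    is_derive t 1 c v ->
    exists2 l : R, is_derive t 1 (fun t => F (param i (c t))) l &
      l ^+ 2 <= C * weighted_sqnorm (h (c t)) v.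

Definition chart_cvg d (M : manifold R d) (s : nat -> M) (i : chart M) (x : M) : Prop :=
  [/\ dom i x, \forall n \near \oo, dom i (s n) &
      forall b, coord i (s n) 0 b @[n --> \oo] --> coord i x 0 b].

(* Bounded Lipschitz functions that detect convergence in a chart replace the
   compactness of the factors. *)
Definition embedded d (M : manifold R d) (h : 'rV[R]_d -> 'rV[R]_d) : Prop :=
  exists (I : Type) (Phi : I -> M -> R) (C : R),
  [/\ 0 <= C, forall a x, `|Phi a x| <= 1,
      forall a, lipschitz_fun h C (Phi a) &
      forall s : nat -> M, (forall a, exists l : R, Phi a (s n) @[n --> \oo] --> l) ->
        exists i x, chart_cvg s i x].

Lemma embedded_one_point h : embedded (one_point R) h.
Proof.
exists Empty_set,
  (fun (a : Empty_set) (_ : one_point R) => match a return R with end), 0.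
split; [exact: lexx|by case|by case|move=> s _].
exists tt, tt; split=> //; last by case.
by near=> n.
Unshelve. all: by end_near. Qed.

Lemma weighted_sqnorm_ge0 d (h v : 'rV[R]_d) : (forall b, 0 <= h 0 b) ->
  0 <= weighted_sqnorm h v.
Proof. by move=> h0; apply: sumr_ge0 => b _; rewrite mulr_ge0 ?sqr_ge0. Qed.

Lemma weighted_sqnorm_split m n (h v : 'rV[R]_(m + n)) : weighted_sqnorm h v =
  weighted_sqnorm (lsubmx h) (lsubmx v) + weighted_sqnorm (rsubmx h) (rsubmx v).
Proof.
rewrite /weighted_sqnorm big_split_ord /=.
by congr (_ + _); apply: eq_bigr => b _; rewrite !mxE.
Qed.

Lemma embedded_prod d1 d2 (M1 : manifold R d1) (M2 : manifold R d2)
    (h1 : 'rV[R]_d1 -> 'rV[R]_d1) (h2 : 'rV[R]_d2 -> 'rV[R]_d2) :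
  (forall u b, 0 <= h1 u 0 b) -> (forall u b, 0 <= h2 u 0 b) ->
  embedded M1 h1 -> embedded M2 h2 ->
  embedded (prod_manifold M1 M2) (fun w => row_mx (h1 (lsubmx w)) (h2 (rsubmx w))).
Proof.
move=> h10 h20 [I1 [P1 [C1 [C10 B1 L1 V1]]]] [I2 [P2 [C2 [C20 B2 L2 V2]]]].
exists (I1 + I2)%type, (fun a (x : M1 * M2) =>
  match a with inl a => P1 a x.1 | inr a => P2 a x.2 end), (C1 + C2); split.
- exact: addr_ge0.
- by case=> a x.
- move=> [a|a] i c t v Hc.
    have [l Hl le_l] := L1 a i.1 _ _ _ (is_derive_lsubmx Hc).
    exists l => //; apply: le_trans le_l _.
    rewrite weighted_sqnorm_split row_mxKl row_mxKr.
    have := weighted_sqnorm_ge0 (lsubmx v) (h10 (lsubmx (c t))).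
    have := weighted_sqnorm_ge0 (rsubmx v) (h20 (rsubmx (c t))).
    by move: (weighted_sqnorm _ _) (weighted_sqnorm _ _) => X Y *; nra.
  have [l Hl le_l] := L2 a i.2 _ _ _ (is_derive_rsubmx Hc).
  exists l => //; apply: le_trans le_l _.
  rewrite weighted_sqnorm_split row_mxKl row_mxKr.
  have := weighted_sqnorm_ge0 (lsubmx v) (h10 (lsubmx (c t))).
  have := weighted_sqnorm_ge0 (rsubmx v) (h20 (rsubmx (c t))).
  by move: (weighted_sqnorm _ _) (weighted_sqnorm _ _) => X Y *; nra.
- move=> s Hs.
  have [i1 [x1 [ix1 d1s cv1]]] := V1 (fun n => (s n).1) (fun a => Hs (inl a)).
  have [i2 [x2 [ix2 d2s cv2]]] := V2 (fun n => (s n).2) (fun a => Hs (inr a)).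
  exists (i1, i2), (x1, x2); split=> //.
    by near=> n; split; near: n.
  move=> b; case: (split_ordP b) => e ->; rewrite /= /prod_coord /=.
    rewrite row_mxEl; under eq_fun do rewrite row_mxEl.
    exact: cv1.
  rewrite row_mxEr; under eq_fun do rewrite row_mxEr.
  exact: cv2.
Unshelve. all: by end_near. Qed.

Lemma sqnorm_curve_derive k (c : R -> 'rV[R]_k) (t : R) v : is_derive t 1 c v ->
  is_derive t 1 (fun t => sqnorm (c t)) (2 * \sum_i c t 0 i * v 0 i).
Proof.
move=> Hc; have H b := is_derive_sqr (is_derive_entry b Hc).
apply: is_derive_eq (is_derive_fsum H) _.
by rewrite mulr_sumr; apply: eq_bigr => b _; rewrite mulrA.
Qed.

Lemma cvg_fsum (I : finType) (F : I -> nat -> R) (l : I -> R) :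
  (forall i, F i n @[n --> \oo] --> l i) ->
  \sum_i F i n @[n --> \oo] --> \sum_i l i.
Proof.
move=> H; elim: (index_enum I) => [|i s IH].
  by rewrite big_nil; under eq_fun do rewrite big_nil; exact: cvg_cst.
rewrite big_cons; under eq_fun do rewrite big_cons.
by apply: cvgD.
Qed.

Lemma stereo_weight_sqnorm k (u v : 'rV[R]_k) :
  weighted_sqnorm (stereo_weight u) v = (1 + sqnorm u)^-1 ^+ 2 * sqnorm v.
Proof. by rewrite /sqnorm mulr_sumr; apply: eq_bigr => b _; rewrite mxE. Qed.

(** For [r = |u|^2], [V = |v|^2], [D = <u, v>], [x = u_b], [w = v_b] and [q = 1 / (1 + r)], the
    square is that of the derivative of [2 q u_b] along [v]. By [(a - b)^2 <= 2 a^2 + 2 b^2] it is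
    at most [8 + 32 = 40] times [q^2 V]. *)
Let stereo_le (q r V D x w : R) :
  q * (1 + r) = 1 -> 0 <= q -> 0 <= r -> x ^+ 2 <= r -> w ^+ 2 <= V ->
  D ^+ 2 <= r * V -> (2 * q * w - 4 * D * x * q ^+ 2) ^+ 2 <= 40 * (q ^+ 2 * V).
Proof.
move=> q1 q0 r0 xr wV DV.
have V0 : 0 <= V by apply: le_trans wV; exact: sqr_ge0.
have qr : q * r <= 1 by nra.
have qr0 : 0 <= q * r by exact: mulr_ge0.
have qq0 : 0 <= q ^+ 2 by exact: sqr_ge0.
have H1 : D ^+ 2 * x ^+ 2 <= r * V * r.
  by apply: ler_pM => //; exact: sqr_ge0.
have H2 : q ^+ 2 * q ^+ 2 * (D ^+ 2 * x ^+ 2) <= q ^+ 2 * V.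
  apply: (@le_trans _ _ (q ^+ 2 * q ^+ 2 * (r * V * r))).
    by rewrite ler_wpM2l // mulr_ge0.
  have -> : q ^+ 2 * q ^+ 2 * (r * V * r) = (q ^+ 2 * V) * ((q * r) * (q * r)) by ring.
  by rewrite ler_piMr ?mulr_ge0 // mulr_ile1.
have H3 : q ^+ 2 * w ^+ 2 <= q ^+ 2 * V by rewrite ler_wpM2l.
have := sqr_ge0 (2 * q * w + 4 * D * x * q ^+ 2).
set Z := q ^+ 2 * V in H2 H3 *.
have -> : (2 * q * w - 4 * D * x * q ^+ 2) ^+ 2 = 8 * (q ^+ 2 * w ^+ 2)
   + 32 * (q ^+ 2 * q ^+ 2 * (D ^+ 2 * x ^+ 2))
   - (2 * q * w + 4 * D * x * q ^+ 2) ^+ 2 by ring.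
lra.
Qed.

Lemma sphere_entry_le1 k (x : sphere_point R k) a : `|val x 0 a| <= 1.
Proof.
rewrite -(expr_le1 (n := 2)) // -normrX ger0_norm ?sqr_ge0 //.
apply: (@le_trans _ _ (sqnorm (val x))); last by rewrite (eqP (valP x)).
rewrite /sqnorm (bigD1 a) //= lerDl; apply: sumr_ge0 => i _; exact: sqr_ge0.
Qed.

Lemma sphere_entry_lipschitz k (a : 'I_(1 + k)) :
  lipschitz_fun (M := sphere_manifold R k) (@stereo_weight R k) 40 (fun x => val x 0 a).
Proof.
move=> i c t v Hc; rewrite stereo_weight_sqnorm.
have s1 (u : 'rV[R]_k) : sqnorm u + 1 != 0 by rewrite gt_eqF // sqnorm1_gt0.
have s1' : 1 + sqnorm (c t) != 0 by rewrite addrC s1.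
have Hs := sqnorm_curve_derive Hc.
have Hs1 : is_derive t 1 (fun t => 1 + sqnorm (c t)) _ :=
  is_derive_add (is_derive_cst (1 : R) t (1 : R)) Hs.
have Hq := is_derive_inv (f := fun t => 1 + sqnorm (c t)) s1' Hs1.
have CS := cauchy_schwarz (fun b => c t 0 b) (fun b => v 0 b).
rewrite -/(sqnorm (c t)) -/(sqnorm v) in CS.
set D := \sum_b _ in Hs Hs1 Hq CS.
have r0 := sqnorm_ge0 (c t); have V0 := sqnorm_ge0 v.
pose q := (1 + sqnorm (c t))^-1.
have q1 : q * (1 + sqnorm (c t)) = 1 by rewrite mulVf.
have q0 : 0 <= q by rewrite invr_ge0 addr_ge0.
case: (split_ordP a) => b ->.
  (* The height of the stereographic point is [1 - 2 q] up to sign. *)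
  have H := is_derive_scale ((-1) ^+ i) (is_derive_add (is_derive_cst (1 : R) t (1 : R))
    (is_derive_scale (-2) Hq)).
  exists ((-1) ^+ i * (4 * D * q ^+ 2)).
    apply: is_derive_ext (is_derive_eq H _).
      move=> y; have -> : lshift k b = 0 by rewrite ord1; exact: val_inj.
      rewrite /= stereo_inv0; have := s1 (c y); rewrite addrC => s1y.
      by rewrite /cst; field; rewrite addrC.
    by rewrite /q; field.
  rewrite exprMn sqrr_sign mul1r.
  have qq : q ^+ 2 <= 1 by rewrite expr_le1 //; nra.
  have qr : q * sqnorm (c t) <= 1 by nra.
  have -> : (4 * D * q ^+ 2) ^+ 2 = 16 * (q ^+ 2 * (q ^+ 2 * D ^+ 2)) by ring.
  have H2 : q ^+ 2 * D ^+ 2 <= sqnorm v.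
    apply: (@le_trans _ _ (q ^+ 2 * (sqnorm (c t) * sqnorm v))).
      by rewrite ler_wpM2l ?sqr_ge0.
    have -> : q ^+ 2 * (sqnorm (c t) * sqnorm v) =
      (q * (q * sqnorm (c t))) * sqnorm v by ring.
    rewrite ler_piMl // mulr_ile1 //; first by rewrite mulr_ge0.
    by nra.
  have H3 : q ^+ 2 * (q ^+ 2 * D ^+ 2) <= q ^+ 2 * sqnorm v.
    by rewrite ler_wpM2l ?sqr_ge0.
  have : 0 <= q ^+ 2 * sqnorm v by rewrite mulr_ge0 ?sqr_ge0.
  rewrite -/q; lra.
have H := is_derive_scale 2 (is_derive_mul Hq (is_derive_entry b Hc)).
exists (2 * q * v 0 b - 4 * D * c t 0 b * q ^+ 2).
  apply: is_derive_ext (is_derive_eq H _).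
    by move=> y; rewrite /= /stereo_inv row_mxEr mxE mulrA [1 + _]addrC.
  by rewrite /q; field.
apply: (@stereo_le _ (sqnorm (c t))) => //.
- rewrite /sqnorm (bigD1 b) //= lerDl; apply: sumr_ge0 => e _; exact: sqr_ge0.
- rewrite /sqnorm (bigD1 b) //= lerDl; apply: sumr_ge0 => e _; exact: sqr_ge0.
Qed.

(** The limit of the ambient coordinates is on the sphere, which is closed. It differs from the pole
    of some chart, and so do the points close to it; there the chart is continuous in the ambient
    coordinates. *)
Lemma embedded_sphere k : embedded (sphere_manifold R k) (@stereo_weight R k).
Proof.
exists 'I_(1 + k), (fun a (x : sphere_point R k) => val x 0 a), 40; split=> //.
- by move=> a x; exact: sphere_entry_le1.
- exact: sphere_entry_lipschitz.
move=> s Hs.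
pose L : 'rV[R]_(1 + k) := \row_a sval (cid (Hs a)).
have HL a : val (s n) 0 a @[n --> \oo] --> L 0 a.
  by rewrite mxE; exact: svalP (cid (Hs a)).
have L1 : sqnorm L == 1.
  apply/eqP.
  have H : sqnorm (val (s n)) @[n --> \oo] --> sqnorm L.
    apply: cvg_fsum => a; rewrite expr2; under eq_fun do rewrite expr2.
    by apply: cvgM.
  have E : (fun n => sqnorm (val (s n))) = (fun=> 1).
    by apply/funext => n; exact/eqP/(valP (s n)).
  rewrite E in H; apply/esym; apply: (cvg_unique _ _ H) => //; exact: cvg_cst.
pose x : sphere_point R k := exist _ L L1.
have [b bx] := sphere_cover x.
exists b, x; split=> //.
  have : \forall y \near (L 0 0), y != (-1) ^+ b.
    exact: (open_nbhs_nbhs (conj (@open_neq R ((-1) ^+ b)) bx)).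
  by move=> /(HL 0).
move=> a; rewrite /= /sphere_coord mxE; under eq_fun do rewrite mxE.
apply: cvgM.
  apply: cvgV; first exact: sphere_den.
  apply: cvgB; first exact: cvg_cst.
  by apply: cvgM; [exact: cvg_cst|exact: HL].
by rewrite mxE; under eq_fun do rewrite mxE; exact: HL.
Qed.

Lemma torus_weight_ge0 j (t : 'rV[R]_j) b : 0 <= torus_weight t 0 b.
Proof. by rewrite mxE sqr_ge0. Qed.

Lemma stereo_weight_ge0 k (t : 'rV[R]_k) b : 0 <= stereo_weight t 0 b.
Proof. by rewrite mxE sqr_ge0. Qed.

Lemma embedded_torus j : embedded (torus R j) (@torus_weight R j).
Proof.
elim: j => [|j IH]; first exact: embedded_one_point.
have := embedded_prod (@stereo_weight_ge0 1) (@torus_weight_ge0 j)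
  (embedded_sphere 1) IH.
rewrite (_ : (fun _ => _) = @torus_weight R j.+1) //.
by apply/funext => t; have /esym := torus_weightS (t : 'rV[R]_(1 + j)).
Qed.

End Embedded.

(** * Length and distance for a diagonal metric *)

Section DiagonalLength.
Local Open Scope classical_set_scope.
Local Open Scope ring_scope.
Variables (R : realType) (d : nat) (M : manifold R d) (g : riemannian_metric M).
Variable w : 'I_d -> 'rV[R]_d -> R.
Hypothesis w_continuous : forall b, continuous (w b).
Hypothesis gE : forall i u, g i u = diag_metric w u.

Let wrow u : 'rV[R]_d := \row_b w b u.

Lemma bilin_diag_metric u v : bilin (diag_metric w u) v v = weighted_sqnorm (wrow u) v.
Proof.
rewrite /bilin !mxE; apply: eq_bigr => b _.
by rewrite /diag_metric mul_mx_diag !mxE; ring.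
Qed.

Lemma continuous_fsum (T : topologicalType) (I : finType) (F : I -> T -> R) :
  (forall i, continuous (F i)) -> continuous (fun x => \sum_i F i x).
Proof.
move=> cF; elim: (index_enum I) => [|i s IH] x.
  by under eq_fun do rewrite big_nil; exact: cvg_cst.
under eq_fun do rewrite big_cons; apply: continuousD; [exact: cF|exact: IH].
Qed.

Let speed (c : R -> 'rV[R]_d) t :=
  Num.sqrt (weighted_sqnorm (wrow (c t)) (derive1 c t)).

Let speed_continuous (c : R -> 'rV[R]_d) :
  (forall t, derivable c t 1) -> continuous (derive1 c) -> continuous (speed c).
Proof.
move=> Dc cc' t.
apply: (@continuous_comp _ _ _
  (fun t => weighted_sqnorm (wrow (c t)) (derive1 c t))); last first.
  exact: sqrt_continuous.
apply: continuous_fsum => b {}t.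
pose f1 t := w b (c t); pose f2 t := derive1 c t 0 b.
have c1 : {for t, continuous f1}.
  apply: (@continuous_comp _ _ _ c (w b)); last exact: w_continuous.
  by apply: differentiable_continuous; exact/derivable1_diffP.
have c2 : {for t, continuous f2}.
  apply: (@continuous_comp _ _ _ (derive1 c) (fun v : 'rV[R]_d => v 0 b)).
    exact: cc'.
  exact: coord_continuous.
rewrite (_ : (fun _ => _) = f1 \* (f2 \* f2)); last first.
  by apply/funext => y; rewrite mxE expr2.
by apply: continuousM => //; exact: continuousM.
Qed.

Let arc_lengthE i c : arc_length g i c =
  \int[lebesgue_measure]_(t in `[0, 1]) speed c t.
Proof. by apply: eq_Rintegral => t _; rewrite gE bilin_diag_metric. Qed.

(** By induction on the arcs: along each one [F] changes at a rate of at most [Num.sqrt C] times the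
    speed. *)
Lemma lipschitz_path_length (F : M -> R) C x y l : 0 <= C -> lipschitz_fun wrow C F ->
  path_length g x y l -> `|F x - F y| <= Num.sqrt C * l.
Proof.
move=> C0 LF; elim=> [z|i c z k [Dc cc' _] _ IH]; first by rewrite subrr normr0 mulr0.
rewrite mulrDr (le_trans (ler_distD (F (param i (c 1))) _ _)) // lerD //.
have csp := speed_continuous Dc cc'.
rewrite arc_lengthE -RintegralZl //; last exact: continuous_integrable_segment.
rewrite distrC.
have H t : exists2 l : R, is_derive t (1 : R) (fun t => F (param i (c t))) l &
    l ^+ 2 <= C * weighted_sqnorm (wrow (c t)) (derive1 c t).
  by apply: LF; rewrite derive1E; apply: derivableP.
apply: (@abs_derive_le_integral R (fun t => F (param i (c t)))).
- move=> t; apply: (@continuousM _ _ (fun=> Num.sqrt C) (speed c) t); last exact: csp.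
  exact: cvg_cst.
- by move=> t; have [e He _] := H t; exact: (@ex_derive _ _ _ _ _ _ _ He).
move=> t; have [e He le_e] := H t.
rewrite (@derive_val _ _ _ _ _ _ _ He) -sqrtr_sqr /speed -sqrtrM //.
exact: ler_wsqrtr.
Qed.

Lemma lipschitz_dist_lt (F : M -> R) C x y e : 0 <= C -> lipschitz_fun wrow C F ->
  (riemannian_dist g x y < e%:E)%E -> `|F x - F y| <= Num.sqrt C * e.
Proof.
move=> C0 LF /ereal_inf_lt[_ [l xyl <-]]; rewrite lte_fin => le.
apply: le_trans (lipschitz_path_length C0 LF xyl) _.
by rewrite ler_wpM2l ?sqrtr_ge0 // ltW.
Qed.

Lemma lipschitz_cauchy_cvg (F : M -> R) C (s : nat -> M) :
  0 <= C -> lipschitz_fun wrow C F ->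
  (forall e : R, 0 < e -> exists N, forall k l, (N <= k)%N -> (N <= l)%N ->
     (riemannian_dist g (s k) (s l) < e%:E)%E) ->
  exists l : R, F (s n) @[n --> \oo] --> l.
Proof.
move=> C0 LF Hs; apply: cauchy_sequence_cvg => e e0.
(* The summand 1 allows the division also when [C = 0]. *)
have C1 : 0 < Num.sqrt C + 1 by rewrite ltr_wpDl ?sqrtr_ge0.
have [N HN] := Hs (e / (Num.sqrt C + 1)) (divr_gt0 e0 C1).
exists N => k l Nk Nl; apply: le_lt_trans (lipschitz_dist_lt C0 LF (HN k l Nk Nl)) _.
by rewrite mulrA ltr_pdivrMr // mulrC ltr_pM2l // ltrDl.
Qed.

Hypothesis chart_imageT : forall (i : chart M) u, chart_image i u.

(** The coordinate segment stays in the chart, whose image is everything, and a bound on the weights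
    along it bounds its speed. *)
Lemma segment_dist_le (i : chart M) x y B : dom i x -> dom i y ->
  (forall t b, 0 <= t <= 1 -> w b (coord i x + t *: (coord i y - coord i x)) <= B) ->
  (riemannian_dist g x y <= (Num.sqrt (B * sqnorm (coord i y - coord i x)))%:E)%E.
Proof.
move=> ix iy wB; set u := coord i x in wB *; set v := coord i y - u.
pose c (t : R) := u + t *: v.
have Hc (t : R) : is_derive t (1 : R) c v.
  apply: is_derive_row => b.
  have H := is_derive_add (is_derive_cst (u 0 b) t (1 : R))
    (is_derive_scale (v 0 b) (is_derive_id t (1 : R))).
  apply: is_derive_ext (is_derive_eq H _) => [y'|].
    by rewrite /c !mxE /cst /= mulrC.
  by rewrite add0r mulr1.
have Dc (t : R) : derivable c t 1 by exact: (@ex_derive _ _ _ _ _ _ _ (Hc t)).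
have c'E : derive1 c = fun=> v.
  by apply/funext => t; rewrite derive1E; exact: (@derive_val _ _ _ _ _ _ _ (Hc t)).
have arc : C1_arc i c.
  split; [exact: Dc| |by move=> t _; exact: chart_imageT].
  by rewrite c'E; exact: cst_continuous.
have xE : param i (c 0) = x by rewrite /c scale0r addr0; exact: coordK.
have yE : param i (c 1) = y by rewrite /c scale1r addrC subrK; exact: coordK.
apply: (@le_trans _ _ (arc_length g i c)%:E).
  apply: ereal_inf_lbound; exists (arc_length g i c) => //.
  have := path_cons arc (path_nil g (param i (c 1))).
  by rewrite addr0 {1}xE {1}yE.
rewrite lee_fin arc_lengthE; apply: integral01_le.
  by apply: speed_continuous; [exact: Dc|rewrite c'E; exact: cst_continuous].
move=> t t01; apply: ler_wsqrtr; rewrite c'E /weighted_sqnorm /sqnorm mulr_sumr.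
apply: ler_sum => b _; rewrite mxE; apply: ler_wpM2r; first exact: sqr_ge0.
exact: wB.
Qed.

End DiagonalLength.

(** * The warped weights as a Riemannian metric *)

Section WarpedProduct.
Local Open Scope classical_set_scope.
Local Open Scope ring_scope.
Variables (R : realType) (k j : nat).

Let M := prod_manifold (prod_manifold (sphere_manifold R k) (torus R j)) (line R).

Local Notation W := (@warp_weight R k j).
Local Notation G := (@warp_metric R k j).

Let W_gt0 b u : 0 < W b u.
Proof. exact: blk_weight_gt0 (@warp_scale_gt0 R k j) _ _. Qed.

Lemma warp_metric_smooth (i : chart M) a b : smooth_on (chart_image i)
  (fun u => G u a b).
Proof.
move=> n; apply: (@Ck_subset _ _ _ setT) => //.
have oT := @openT 'rV[R]_(k + j + 1).
have H : Ck n setT (W a) := @blk_weight_smooth R _ _ _ _ _ a n.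
have := Ck_mul oT (Ck_cst n setT (a == b)%:R) H.
by apply: Ck_ext => // u _; rewrite /warp_metric diag_metricE.
Qed.

Lemma warp_metric_sym (i : chart M) u : chart_image i u ->
  (G u)^T = G u.
Proof. by move=> _; rewrite /warp_metric /diag_metric tr_diag_mx. Qed.

Lemma warp_metric_pos (i : chart M) u v : chart_image i u -> v != 0 ->
  0 < bilin (G u) v v.
Proof.
move=> _ v0; rewrite /warp_metric bilin_diag_metric lt_def; apply/andP; split.
  apply: contra_neq v0; rewrite /weighted_sqnorm => /psumr_eq0P H.
  apply/rowP => b; rewrite [RHS]mxE.
  have : (\row_b W b u) 0 b * v 0 b ^+ 2 = 0.
    apply: H => // a _; apply: mulr_ge0; last exact: sqr_ge0.
    by rewrite mxE; exact: ltW (W_gt0 a u).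
  by move=> /eqP; rewrite mxE mulf_eq0 gt_eqF ?W_gt0 // sqrf_eq0 => /eqP.
by apply: weighted_sqnorm_ge0 => b; rewrite mxE ltW // W_gt0.
Qed.

Lemma warp_metric_compat (i i' : chart M) x : dom i x -> dom i' x ->
  G (coord i x) = transition_jac i i' (coord i x)
    *m G (coord i' x) *m (transition_jac i i' (coord i x))^T.
Proof. exact: warp_invariant. Qed.

Definition warp_riemannian : riemannian_metric M :=
  @RiemannianMetric R _ M (fun=> G)
    warp_metric_smooth warp_metric_sym warp_metric_pos warp_metric_compat.

End WarpedProduct.

(** * Completeness of the warped metric *)

Section Completeness.
Local Open Scope classical_set_scope.
Local Open Scope ring_scope.
Variables (R : realType) (k j : nat).

Let M := prod_manifold (prod_manifold (sphere_manifold R k) (torus R j)) (line R).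
Local Notation W := (@warp_weight R k j).
Let s := torus_rate R k j.
Let h (u : 'rV[R]_(k + j + 1)) : 'rV[R]_(k + j + 1) := \row_b W b u.

Lemma chart_image_prod d1 d2 (M1 : manifold R d1) (M2 : manifold R d2) :
  (forall (i : chart M1) u, chart_image i u) ->
  (forall (i : chart M2) u, chart_image i u) ->
  forall (i : chart (prod_manifold M1 M2)) u, chart_image i u.
Proof.
move=> H1 H2 i u; have [x1 d1x e1] := H1 i.1 (lsubmx u).
have [x2 d2x e2] := H2 i.2 (rsubmx u).
by exists (x1, x2) => //; rewrite /= /prod_coord /= e1 e2 hsubmxK.
Qed.

Lemma chart_image_sphere n (i : chart (sphere_manifold R n)) u : chart_image i u.
Proof.
exists (sphere_param i u); [exact: sphere_dom_param|exact: sphere_paramK].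
Qed.

Lemma chart_image_torus n (i : chart (torus R n)) u : chart_image i u.
Proof.
elim: n i u => [i u|n IH]; first by exists tt => //; apply/rowP => -[].
by apply: chart_image_prod => //; exact: chart_image_sphere.
Qed.

Lemma chart_image_line (i : chart (line R)) u : chart_image i u.
Proof. by exists (u 0 0) => //; exact: line_paramK. Qed.

Lemma chart_image_warp (i : chart M) u : chart_image i u.
Proof.
apply: chart_image_prod; last exact: chart_image_line.
by apply: chart_image_prod; [exact: chart_image_sphere|exact: chart_image_torus].
Qed.

Lemma weighted_sqnormZ n (c : R) (a v : 'rV[R]_n) :
  weighted_sqnorm (c *: a) v = c * weighted_sqnorm a v.
Proof.
rewrite /weighted_sqnorm mulr_sumr.
by apply: eq_bigr => b _; rewrite mxE mulrA.
Qed.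

Let normS (u v : 'rV[R]_(k + j + 1)) :=
  weighted_sqnorm (@stereo_weight R k (lsubmx (lsubmx u))) (lsubmx (lsubmx v)).
Let normT (u v : 'rV[R]_(k + j + 1)) :=
  weighted_sqnorm (@torus_weight R j (rsubmx (lsubmx u))) (rsubmx (lsubmx v)).

Let hE u v : weighted_sqnorm (h u) v =
  4 / (1 + s) * expR (- rsubmx u 0 0 ^+ 2) * normS u v
  + expR (s * rsubmx u 0 0 ^+ 2) * normT u v + rsubmx v 0 0 ^+ 2.
Proof.
rewrite /h warp_weightE !weighted_sqnorm_split !(row_mxKl, row_mxKr) !weighted_sqnormZ.
by congr (_ + _); rewrite /weighted_sqnorm big_ord1 mxE mul1r.
Qed.

Let normS_ge0 u v : 0 <= normS u v.
Proof. by apply: weighted_sqnorm_ge0 => b; exact: stereo_weight_ge0. Qed.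

Let normT_ge0 u v : 0 <= normT u v.
Proof. by apply: weighted_sqnorm_ge0 => b; exact: torus_weight_ge0. Qed.

Let s_ge0 : 0 <= s := torus_rate_ge0 R k j.

Lemma height_lipschitz : lipschitz_fun (M := M) h 1 (fun x => x.2).
Proof.
move=> i c t v Hc; exists (rsubmx v 0 0).
  exact: is_derive_entry (is_derive_rsubmx Hc).
rewrite mul1r hE lerDr addr_ge0 // mulr_ge0 ?expR_ge0 //.
by rewrite mulr_ge0 ?expR_ge0 // divr_ge0 // addr_ge0.
Qed.

(** The torus only expands: its warping factor [e^(s r^2)] is at least 1, so the constant is
    unchanged. *)
Lemma torus_lipschitz C (F : torus R j -> R) : 0 <= C ->
  lipschitz_fun (@torus_weight R j) C F ->
  lipschitz_fun (M := M) h C (fun x => F x.1.2).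
Proof.
move=> C0 LF i c t v Hc.
have [l Hl le_l] := LF i.1.2 _ _ _ (is_derive_rsubmx (is_derive_lsubmx Hc)).
exists l => //; apply: le_trans le_l _; rewrite hE ler_wpM2l //.
rewrite -/(normT (c t) v).
have E1 : 1 <= expR (s * rsubmx (c t) 0 0 ^+ 2).
  by rewrite -(@expR0 R) ler_expR mulr_ge0 ?sqr_ge0.
have HS : 0 <= 4 / (1 + s) * expR (- rsubmx (c t) 0 0 ^+ 2) * normS (c t) v.
  by rewrite mulr_ge0 // mulr_ge0 ?expR_ge0 // divr_ge0 // addr_ge0.
have HT : normT (c t) v <= expR (s * rsubmx (c t) 0 0 ^+ 2) * normT (c t) v.
  by rewrite ler_peMl.
have := sqr_ge0 (rsubmx v 0 0); lra.
Qed.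

(* The warping factor [exp (- r^2 / 2)] makes the ambient coordinates of the sphere
   Lipschitz on the whole manifold, although the spheres shrink as r grows. *)
Lemma sphere_lipschitz C (F : sphere_manifold R k -> R) :
  0 <= C -> (forall x, `|F x| <= 1) ->
  lipschitz_fun (@stereo_weight R k) C F ->
  lipschitz_fun (M := M) h (C * (1 + s) + 2)
    (fun x => expR (- 2^-1 * x.2 ^+ 2) * F x.1.1).
Proof.
move=> C0 F1 LF i c t v Hc.
have [l Hl le_l] := LF i.1.1 _ _ _ (is_derive_lsubmx (is_derive_lsubmx Hc)).
have Hr := is_derive_entry (0 : 'I_1) (is_derive_rsubmx Hc).
have HE := is_derive_expR_comp (is_derive_scale (- 2^-1) (is_derive_sqr Hr)).
set r := rsubmx (c t) 0 0 in HE *; set w := rsubmx v 0 0 in HE *.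
pose f := F (param i.1.1 (lsubmx (lsubmx (c t)))).
pose E := expR (- 2^-1 * r ^+ 2).
exists (E * (l - r * w * f)).
  apply: is_derive_eq (is_derive_mul HE Hl) _.
  by rewrite /E /f -/r; field.
have EE : E ^+ 2 = expR (- r ^+ 2) by rewrite /E expr2 -expRD; congr expR; field.
have f2 : f ^+ 2 <= 1 by rewrite -[f ^+ 2]ger0_norm ?sqr_ge0 // normrX expr_le1 // F1.
(* The derivative of the cut-off [E] is bounded because [r^2 e^(- r^2) <= 1], once more by
   [e^x >= 1 + x]. *)
have rE : r ^+ 2 * E ^+ 2 <= 1.
  have E1 := expR_ge1Dx (r ^+ 2).
  have : E ^+ 2 * expR (r ^+ 2) = 1 by rewrite EE -expRD addNr expR0.
  have := sqr_ge0 E; have := sqr_ge0 r.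
  by move: (E ^+ 2) (expR (r ^+ 2)) (r ^+ 2) E1 => X Y Z *; nra.
rewrite hE -/r -/w -EE.
have nS := normS_ge0 (c t) v; have nT := normT_ge0 (c t) v.
rewrite -/(normS (c t) v) in le_l.
have E0 := sqr_ge0 E; have w0 := sqr_ge0 w.
have T0 : 0 <= expR (s * r ^+ 2) * normT (c t) v by rewrite mulr_ge0 ?expR_ge0.
have H1 : E ^+ 2 * l ^+ 2 <= E ^+ 2 * (C * normS (c t) v) by rewrite ler_wpM2l.
have H2 : (r ^+ 2 * E ^+ 2) * f ^+ 2 * w ^+ 2 <= w ^+ 2.
  rewrite ler_piMl // mulr_ile1 //; last exact: sqr_ge0.
  by rewrite mulr_ge0 ?sqr_ge0.
have s1 : 1 + s != 0 by rewrite gt_eqF // ltr_pwDl.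
have -> : (C * (1 + s) + 2) * (4 / (1 + s) * E ^+ 2 * normS (c t) v +
    expR (s * r ^+ 2) * normT (c t) v + w ^+ 2) =
    4 * (E ^+ 2 * (C * normS (c t) v)) + 2 * (4 / (1 + s) * E ^+ 2 * normS (c t) v)
    + (C * (1 + s) + 2) * (expR (s * r ^+ 2) * normT (c t) v)
    + C * (1 + s) * w ^+ 2 + 2 * w ^+ 2 by field.
have P1 : 0 <= 4 / (1 + s) * E ^+ 2 * normS (c t) v.
  by rewrite mulr_ge0 // mulr_ge0 // divr_ge0 // addr_ge0.
have P2 : 0 <= (C * (1 + s) + 2) * (expR (s * r ^+ 2) * normT (c t) v).
  by rewrite mulr_ge0 // addr_ge0 // mulr_ge0 // addr_ge0.
have P3 : 0 <= C * (1 + s) * w ^+ 2 by rewrite mulr_ge0 // mulr_ge0 // addr_ge0.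
have P4 : 0 <= E ^+ 2 * (C * normS (c t) v) by rewrite mulr_ge0 // mulr_ge0.
(* This is [(a - b)^2 <= 2 a^2 + 2 b^2]: the variation of [F] is paid by the sphere term with
   [C (1 + s)], that of the cut-off by [2 w^2]. *)
have := sqr_ge0 (E * (l + r * w * f)).
have -> : (E * (l - r * w * f)) ^+ 2 = 2 * (E ^+ 2 * l ^+ 2)
   + 2 * ((r ^+ 2 * E ^+ 2) * f ^+ 2 * w ^+ 2) - (E * (l + r * w * f)) ^+ 2 by ring.
lra.
Qed.

(** A bound by [r] alone, so a segment of bounded height has bounded weights wherever it runs in the
    sphere and torus coordinates. *)
Lemma warp_weight_le b u : W b u <= 4 * expR (s * u 0 (idxR k j) ^+ 2).
Proof.
rewrite /warp_weight /blk_weight.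
have r0 := sqr_ge0 (u 0 (idxR k j)).
have kap4 : warp_scale R b <= 4.
  rewrite /warp_scale; case: ifP => // _; last by rewrite ler1n.
  by rewrite ler_pdivrMr ?ltr_pwDl // ler_peMr // lerDl.
have rate : warp_rate R b <= s.
  rewrite /warp_rate; case: ifP => _; last by case: ifP.
  by apply: le_trans s_ge0; rewrite lerN10.
have q1 : (1 + blk_sqnorm (idxR k j) (@factor_blk k j) b u)^-1 ^+ 2 <= 1.
  have q0 := blk_sqnorm_ge0 (idxR k j) (@factor_blk k j) b u.
  by rewrite expr_le1 ?invr_ge0 ?addr_ge0 // invf_le1 ?lerDl // ltr_pwDl.
have E1 : expR (warp_rate R b * u 0 (idxR k j) ^+ 2) <= expR (s * u 0 (idxR k j) ^+ 2).
  by rewrite ler_expR ler_wpM2r.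
apply: ler_pM => //; first exact: ltW (warp_scale_gt0 _ _).
  by apply: mulr_ge0; [exact: expR_ge0|exact: sqr_ge0].
by apply: le_trans E1; rewrite ler_piMr ?expR_ge0.
Qed.

Lemma warp_complete : complete_metric (warp_riemannian R k j).
Proof.
move=> p Hp.
pose g := warp_riemannian R k j.
have W_cont b : continuous (W b) by exact: blk_weight_continuous.
have gE i u : g i u = diag_metric W u by [].
have cvgF (F : M -> R) C : 0 <= C -> lipschitz_fun h C F ->
    exists l : R, F (p n) @[n --> \oo] --> l.
  by move=> C0 LF; exact: (lipschitz_cauchy_cvg W_cont gE C0 LF Hp).
have [r cvr] := cvgF _ _ ler01 height_lipschitz.
have [I1 [P1 [C1 [C10 B1 L1 V1]]]] := @embedded_sphere R k.
have [I2 [P2 [C2 [C20 B2 L2 V2]]]] := @embedded_torus R j.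
have [|i1 [x1 [d1x d1p cv1]]] := V1 (fun n => (p n).1.1).
  move=> a.
  have C0 : 0 <= C1 * (1 + s) + 2 by rewrite addr_ge0 // mulr_ge0 // addr_ge0.
  have [l Hl] := cvgF _ _ C0 (sphere_lipschitz C10 (B1 a) (L1 a)).
  (* As the heights converge, the factor [e^(- r^2 / 2)] can be divided out in the limit. *)
  exists (expR (2^-1 * (r * r)) * l).
  rewrite (_ : (fun n => P1 a (p n).1.1) = fun n => expR (2^-1 * ((p n).2 * (p n).2)) *
     (expR (- 2^-1 * (p n).2 ^+ 2) * P1 a (p n).1.1)); last first.
    apply/funext => n; rewrite mulrA -expRD -expr2 -mulrDl.
    by rewrite subrr mul0r expR0 mul1r.
  apply: cvgM => //.
  apply: (@cvg_comp _ _ _ (fun n => 2^-1 * ((p n).2 * (p n).2)) expR);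
    last exact: continuous_expR.
  by apply: cvgM; [exact: cvg_cst|exact: cvgM].
have [|i2 [x2 [d2x d2p cv2]]] := V2 (fun n => (p n).1.2).
  by move=> a; exact: cvgF C20 (torus_lipschitz C20 (L2 a)).
pose i : chart M := ((i1, i2), tt); pose x : M := ((x1, x2), r).
have ix : dom i x by [].
exists x => e e0.
(* Once the height of [p n] is within 1 of [r], the segment to the limit stays at heights of
   absolute value at most [|r| + 1]. *)
pose B := 4 * expR (s * (`|r| + 1) ^+ 2).
have coordR (y : M) : coord i y 0 (idxR k j) = y.2.
  by rewrite /= /prod_coord /idxR row_mxEr mxE.
have cvc b : coord i (p n) 0 b @[n --> \oo] --> coord i x 0 b.
  elim/idxP: b => [a|a|].
  - rewrite /= /prod_coord /= row_mxEl /prod_coord /= row_mxEl.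
    by under eq_fun do rewrite row_mxEl row_mxEl; exact: cv1.
  - rewrite /= /prod_coord /= row_mxEl /prod_coord /= row_mxEr.
    by under eq_fun do rewrite row_mxEl row_mxEr; exact: cv2.
  - by rewrite coordR; under eq_fun do rewrite coordR; exact: cvr.
have cvd : Num.sqrt (B * sqnorm (coord i x - coord i (p n))) @[n --> \oo] --> (0 : R).
  rewrite -[X in _ --> X](@sqrtr0 R).
  apply: (@cvg_comp _ _ _
    (fun n => B * sqnorm (coord i x - coord i (p n))) Num.sqrt); last first.
    exact: sqrt_continuous.
  rewrite -(mulr0 B); apply: cvgM; first exact: cvg_cst.
  rewrite (_ : 0 = \sum_(b < k + j + 1) 0 * 0); last first.
    by rewrite big1 // => b _; rewrite mul0r.
  apply: cvg_fsum => b; under eq_fun do rewrite expr2.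
  have cvb : (coord i x - coord i (p n)) 0 b @[n --> \oo] --> (0 : R).
    rewrite (_ : (fun n => _) = fun n => coord i x 0 b - coord i (p n) 0 b); last first.
      by apply/funext => n; rewrite [LHS]mxE; congr (_ + _); rewrite [LHS]mxE.
    rewrite -(subrr (coord i x 0 b)); apply: cvgB; [exact: cvg_cst|exact: cvc].
  exact: cvgM.
suff [N _ HN] : \forall n \near \oo, (riemannian_dist g (p n) x < e%:E)%E.
  by exists N => n; exact: HN.
near=> n.
have ip : dom i (p n) by split=> //; split; near: n.
have rn : `|r - (p n).2| < 1 by near: n; move/cvgrPdist_lt: cvr; apply; exact: ltr01.
apply: le_lt_trans (segment_dist_le W_cont gE chart_image_warp ip ix (B := B) _) _.
  move=> t b /andP[t0 t1]; apply: le_trans (warp_weight_le _ _) _.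
  rewrite ler_pM2l ?ltr0n // ler_expR ler_wpM2l //.
  have -> : (coord i (p n) + t *: (coord i x - coord i (p n))) 0 (idxR k j) =
      (p n).2 + t * (r - (p n).2).
    rewrite -!coordR [LHS]mxE; congr (_ + _); rewrite [LHS]mxE; congr (_ * _).
    by rewrite [LHS]mxE; congr (_ + _); [exact: (coordR x)|rewrite [LHS]mxE].
  set z := (X in X ^+ 2 <= _).
  have -> : z = r - (1 - t) * (r - (p n).2) by rewrite /z; ring.
  rewrite -real_normK ?num_real // ler_sqr ?nnegrE ?addr_ge0 //.
  apply: le_trans (ler_normB _ _) _; rewrite lerD2l normrM.
  by rewrite mulr_ile1 // ?(ltW rn) // ger0_norm; lra.
rewrite lte_fin; near: n.
move/cvgrPdist_lt: cvd => /(_ e e0); apply: filterS => n.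
by rewrite sub0r normrN ger0_norm ?sqrtr_ge0.
Unshelve. all: by end_near.
Qed.
End Completeness.

Theorem theorem1p4 (R : realType) (n m : nat)
  (hn : (6 <= n <= 7)%N) (hm : (2 <= m <= n - 3)%N) :
  exists g : riemannian_metric
      (prod_manifold
         (prod_manifold (sphere_manifold R (n - m)) (torus R (m - 1)))
         (line R)),
    complete_metric g /\ uniformly_positive_intermediate_curvature m g.
Proof.
(* The condition [2 m <= j k] is checked on (6,2), (6,3), (7,2), (7,3) and (7,4); it is an equality
   for [n = 6]. *)
have [jk k0 mE] : [/\ (2 * (m - 1).+1 <= (m - 1) * (n - m))%N, (0 < n - m)%N &
    m = (m - 1).+1].
  case: n hn hm => [|[|[|[|[|[|[|[|n]]]]]]]] // _.
    by case: m => [|[|[|[|m]]]].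
  by case: m => [|[|[|[|[|m]]]]].
exists (warp_riemannian R (n - m) (m - 1)); split; first exact: warp_complete.
exists (torus_rate R (n - m) (m - 1)).
  by rewrite /torus_rate divr_gt0 // ltr0n.
move=> x i ix; apply: le_ereal_inf_tmp => _ [e He <-].
rewrite lee_fin [X in frame_curvature X]mE.
exact: warp_frame_curvature_ge.
Qed.
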